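(* Let $L=\sum_{k=0}^{N}V_k(x)\partial_x^k$, with $V_N=1$ and $V_{N-1}=0$, be a bispectral operator with $\lim_{x\to\infty}V_j(x)=0$ for all $j=0,\dots,N-1$. Then the point $x=\infty$ is a regular singular point of $L$.
   Context: $L(x,\partial_x)$ is called bispectral if there are a differential operator $\Lambda(z,\partial_z)$, nonconstant functions $f(z)$, $\theta(x)$, and a function $\psi(x,z)$, not identically zero, with $L\psi=f(z)\psi$ and $\Lambda\psi=\theta(x)\psi$. It is well known that with the normalization $V_N=1$, $V_{N-1}=0$ the coefficients of a bispectral operator are rational functions (so the limit condition makes sense). The point $x=\infty$ is called regular singular for $L$ if it is at worst a regular singular point of the linear ODE $L\phi=0$, i.e. $V_{N-i}(x)=O(x^{-i})$ as $x\to\infty$ for $i=1,\dots,N$. *)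

(* Defs.v *)
From HB Require Import structures.
From mathcomp Require Import all_boot all_order all_algebra.
From mathcomp Require Import all_classical all_reals all_analysis.
From mathcomp Require Import complex.

Set Implicit Arguments.
Unset Strict Implicit.
Unset Printing Implicit Defensive.

Import Order.TTheory GRing.Theory Num.Theory.
Import numFieldNormedType.Exports.

Local Open Scope classical_set_scope.
Local Open Scope ring_scope.

(* mathcomp-analysis provides a topology, norm and derivative on R[i] only
   through its numFieldType structure. *)
Definition complexes (R : realType) : numFieldType := complex R.

(* The order of R[i] is partial: r < `|x| is false when r is not real, so
   radii have to be required real (0 < r, or r \is Num.real). *)

Definition domain (K : numFieldType) (U : set K) : Prop :=
  [/\ open U, connected U & U !=set0].

Definition analytic_on (K : numFieldType) (U : set K) (f : K -> K) : Prop :=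
  forall a, U a -> exists2 r : K, 0 < r & exists c : nat -> K,
    forall x, `|x - a| < r ->
      (\sum_(i < n) c i * (x - a) ^+ i) @[n --> \oo] --> f x.

(* Joint analyticity: near each point of U x W, psi is the sum of an absolutely
   convergent double power series. *)
Definition analytic2_on (K : numFieldType) (U W : set K) (psi : K -> K -> K)
    : Prop :=
  forall a b, U a -> W b -> exists2 r : K, 0 < r &
    exists c : nat -> nat -> K,
    forall x z, `|x - a| < r -> `|z - b| < r ->
      (exists M : K, forall n : nat,
         \sum_(i < n) \sum_(j < n) `|c i j * (x - a) ^+ i * (z - b) ^+ j| <= M)
      /\ (\sum_(i < n) \sum_(j < n) c i j * (x - a) ^+ i * (z - b) ^+ j)
           @[n --> \oo] --> psi x z.

Definition nonconstant_on (K : numFieldType) (U : set K) (f : K -> K) : Prop :=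
  exists x y, [/\ U x, U y & f x != f y].

Definition diffop (K : numFieldType) (N : nat) (V : nat -> K -> K)
    (g : K -> K) (x : K) : K :=
  \sum_(k < N.+1) V k x * derive1n k g x.

Definition bispectral (K : numFieldType) (N : nat) (V : nat -> K -> K) : Prop :=
  exists U W : set K,
  exists (M : nat) (A : nat -> K -> K) (f theta : K -> K) (psi : K -> K -> K),
    [/\ domain U, domain W,
        (forall k, (k <= N)%N -> analytic_on U (V k)) &
        (forall k, (k <= M)%N -> analytic_on W (A k))] /\
    [/\ analytic_on W f, nonconstant_on W f,
        analytic_on U theta & nonconstant_on U theta] /\
    [/\ analytic2_on U W psi,
        (exists x z, [/\ U x, W z & psi x z != 0]),
        (forall x z, U x -> W z ->
           diffop N V (fun y => psi y z) x = f z * psi x z) &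
        (forall x z, U x -> W z ->
           diffop M A (psi x) z = theta x * psi x z)].

(* The values at the zeros of q (the possible poles) are irrelevant. *)
Definition rational_fun (K : numFieldType) (f : K -> K) : Prop :=
  exists p q : {poly K}, q != 0 /\
    forall x, q.[x] != 0 -> f x = p.[x] / q.[x].

(* Neighbourhoods of the point at infinity of the Riemann sphere. *)
Definition infty_nbhs (K : numFieldType) : set_system K :=
  [set A | exists r : K, r \is Num.real /\ (forall x : K, r < `|x| -> A x)].
Arguments infty_nbhs K : clear implicits.

Global Instance infty_nbhs_filter (K : numFieldType) : Filter (infty_nbhs K).
Proof.
split=> [|A B [r [rR rA]] [s [sR sB]]|A B AB [r [rR rA]]].
- by exists 0; split.
- exists (Num.max r s); split; first by rewrite max_real.
  move=> x; rewrite comparable_gt_max ?real_comparable// => /andP[/rA Ax /sB Bx].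
  by split.
- by exists r; split=> // x /rA /AB.
Qed.

Canonical infty_nbhs_filterType (K : numFieldType) :=
  FilterType (infty_nbhs K) (infty_nbhs_filter K).

Definition regular_singular_at_infty (K : numFieldType) (N : nat)
    (V : nat -> K -> K) : Prop :=
  forall i : nat, (1 <= i <= N)%N ->
    let oo := infty_nbhs K in V (N - i)%N =O_oo (fun x : K => x ^- i).

(* Main.v *)
Require Import Defs.
From HB Require Import structures.
From mathcomp Require Import all_boot all_order all_algebra all_field.
From mathcomp Require Import all_classical all_reals all_analysis.
From mathcomp Require Import complex ring lra zify.

(** Why the theorem is true.  Write L = sum_k V_k d^k of order N and
    Lambda psi = theta psi, Lambda of order m.

    Nilpotency.  L acts on x and Lambda on z, so they commute, and L - f(z)
    applied to Lambda psi = theta psi gives [Lambda, f] psi, an operator in z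
    of order one less.  Hence (L - f(z))^(m+1) (theta psi) = 0.  Computed
    in x, the same function is ad(L)^(m+1)(theta) psi: an operator with
    coefficients free of z.  As f is not constant, the z-expansion of psi
    supplies infinitely many independent functions of x that this operator
    kills, so it vanishes ([ad_theta_eq0]).  Its top coefficient is
    N^(m+1) theta^(m+1) because V_N = 1; so theta is a polynomial, of some
    degree n > 0 ([theta_polynomial]).

    Classical limit.  Let V_(N-i) behave like c_i x^(-d_i).  The limit
    condition says d_i > 0; if infinity is not regular singular, then
    min d_i / i = al / be with 0 < al < be coprime.  Give x weight be and d
    weight -al.  The part of L of top weight is, up to a power of x, a
    polynomial p(eta) in eta = x^(al/be) d, namely eta^N plus the terms
    c_i eta^(N-i) with be d_i = al i; it is not eta^N.  Since al < be, the
    top part of a commutator is the Poisson bracket of the top parts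
    ([has_symbol_opcomm]).  So ad(L)^k(theta) has a symbol g_k(eta) with
    g_0 a nonzero constant and
      be g_(k+1) = w_k p' g_k + N al p g_k',
      w_k = be n - k (be + (N-1) al),
    and nilpotency forces some g_k to vanish.

    This is impossible ([bracket_iterates_neq0]).  Degrees show that the last
    nonzero term would be g_n.  At a root of p of multiplicity mu, the equation
    g_(n+1) = 0 forces g_n to vanish to order n (N-1) mu / N, and the equation
    for g_n then forces g_(n-1) to vanish to that order plus 1 - mu, unless two
    leading terms cancel.  Cancellation is excluded by arithmetic, using that
    p is, up to a factor, invariant under rotation by be-th roots of unity.
    Summing over the h distinct roots gives n (N-1) + h - N <= deg g_(n-1),
    while deg g_(n-1) <= (n-1)(N-1); so h <= 1.  But p has a nonzero root,
    and its rotations by be > 1 roots of unity are roots too.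

    The passage from functions to algebra goes through Taylor expansions at a
    point where psi does not vanish: [bispectral_formal] turns the bispectral
    equations into identities between formal power series, and growth at
    infinity of a rational function is read off its Taylor series at that point
    ([has_weight]). *)
Set Implicit Arguments.
Unset Strict Implicit.
Unset Printing Implicit Defensive.
Import Order.TTheory GRing.Theory Num.Theory.
Import numFieldNormedType.Exports.
Local Open Scope ring_scope.

(** * Top coefficients and multiplicities of polynomials *)

(** Unlike the leading coefficient, c may be zero: this makes the predicate
    stable under sums at a fixed W, which is how cancellations are handled. *)
Definition has_top (K : nzRingType) (b : {poly K}) (W : nat) (c : K) :=
  (size b <= W.+1)%N /\ b`_W = c.

Section Top.
Variable K : comNzRingType.
Implicit Types (a b : {poly K}) (c d : K) (V W : nat).

Lemma has_topM a b V W c d :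
  has_top a V c -> has_top b W d -> has_top (a * b) (V + W) (c * d).
Proof.
move=> [sa <-] [sb <-]; split.
  by apply: leq_trans (size_polyMleq _ _) _; lia.
rewrite coefM (bigD1 (inord V)) //= inordK ?ltnS ?leq_addr// addKn.
rewrite big1 ?addr0// => i ne_iV.
have [lt_iV|le_Vi] := ltnP i V.
  by rewrite [b`__]nth_default ?mulr0//; apply: leq_trans sb _; lia.
rewrite [a`_i]nth_default ?mul0r//; apply: leq_trans sa _.
rewrite ltn_neqAle le_Vi andbT; apply: contraNneq ne_iV => e.
by apply/eqP/val_inj; rewrite /= inordK ?ltnS ?leq_addr.
Qed.

Lemma has_topD a b W c d :
  has_top a W c -> has_top b W d -> has_top (a + b) W (c + d).
Proof.
move=> [sa <-] [sb <-]; split; last by rewrite coefD.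
by apply: leq_trans (size_polyD _ _) _; rewrite geq_max sa.
Qed.

Lemma has_topZ a W c d : has_top a W c -> has_top (d *: a) W (d * c).
Proof.
move=> [sa <-]; split; last by rewrite coefZ.
exact: leq_trans (size_scale_leq _ _) sa.
Qed.

(** The Euler operator X d/dX is used in place of the derivative because it
    preserves the bound W, also for W = 0. *)
Lemma has_top_euler a W c :
  has_top a W c -> has_top ('X * a^`()) W (W%:R * c).
Proof.
move=> [sa <-]; split; last first.
  by rewrite coefXM coef_deriv; case: W sa => [|W] _ /=; rewrite ?mul0r ?mulr_natl.
apply/leq_sizeP => -[//|j] ltWj; rewrite coefXM coef_deriv /=.
by rewrite nth_default ?mul0rn//; apply: leq_trans sa ltWj.
Qed.

Lemma has_topXn a W V c :
  has_top ('X^V * a) (V + W) c <-> has_top a W c.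
Proof.
have E j : ('X^V * a)`_(V + j) = a`_j.
  by rewrite coefXnM addKn ltnNge leq_addr.
split=> -[s e]; split; rewrite ?E// -?e ?E//; apply/leq_sizeP => j ltWj.
  by rewrite -E; apply: (leq_sizeP _ _ s); lia.
rewrite coefXnM; case: ltnP => // leVj.
by rewrite nth_default //; apply: leq_trans s _; lia.
Qed.

Lemma has_topX a W c : has_top ('X * a) W.+1 c <-> has_top a W c.
Proof. exact: (has_topXn a W 1 c). Qed.

End Top.

(** With p = (X-c)^i p1 and g = (X-c)^j g1, the terms a p' g and b p g' both
    vanish to order i + j - 1 at c, with leading coefficients a i p1 g1 and
    b j p1 g1 there; w is the factor left after adding them. *)
Lemma mup_bracket (K : fieldType) (a b c : K) (p g : {poly K}) :
  p != 0 -> g != 0 ->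
  let h := a *: (p^`() * g) + b *: (p * g^`()) in
  let w := a * (mup c p)%:R + b * (mup c g)%:R in
  w != 0 -> h != 0 /\ (mup c h).+1 = (mup c p + mup c g)%N.
Proof.
move=> p0 g0 h w w0.
have [i [p1 + Dp]] := multiplicity_XsubC p c; rewrite p0 /= => p1c.
have [j [g1 + Dg]] := multiplicity_XsubC g c; rewrite g0 /= => g1c.
have Ei : mup c p = i by rewrite Dp mupMr// mup_XsubCX eqxx.
have Ej : mup c g = j by rewrite Dg mupMr// mup_XsubCX eqxx.
set u := 'X - c%:P in Dp Dg.
pose q := (a * i%:R + b * j%:R) *: (p1 * g1)
          + u * (a *: (p1^`() * g1) + b *: (p1 * g1^`())).
have uD k (r : {poly K}) : u * (r * u ^+ k)^`() = (k%:R *: r + u * r^`()) * u ^+ k.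
  rewrite derivM deriv_exp derivXsubC mul1r; case: k => [|k] /=.
    by rewrite mulr0n mulr0 addr0 scale0r add0r expr0 !mulr1.
  by rewrite -mulr_natl exprS -mul_polyC polyCMn; ring.
have Dh : u * h = q * u ^+ (i + j).
  have -> : u * h = a *: ((u * p^`()) * g) + b *: (p * (u * g^`())).
    by rewrite /h -!mul_polyC; ring.
  rewrite Dp Dg !uD /q exprD -!mul_polyC !rmorphD !rmorphM /=.
  by ring.
have qc : ~~ root q c.
  rewrite rootE /q !hornerE subrr mul0r addr0 !mulf_neq0// -?Ei -?Ej//.
have q0 : q != 0 by apply: contraNneq qc => ->; rewrite root0.
have u0 : u != 0 by rewrite polyXsubC_eq0.
have h0 : h != 0.
  apply: contra_eqN Dh => /eqP->; rewrite mulr0 eq_sym mulf_neq0//.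
  by rewrite expf_neq0.
split=> //; have := congr1 (mup c) Dh.
by rewrite mupM// (@mup_XsubCX _ 1) eqxx mupMr// mup_XsubCX eqxx Ei Ej.
Qed.

Lemma sum_mup_le (K : fieldType) (s : seq K) (q : {poly K}) :
  uniq s -> q != 0 -> (\sum_(c <- s) mup c q < size q)%N.
Proof.
elim: s q => [|c s IH] q; first by rewrite big_nil size_poly_gt0.
rewrite big_cons => /= /andP[cs us] q0.
have [i [q1 + Dq]] := multiplicity_XsubC q c; rewrite q0 /= => q1c.
have q10 : q1 != 0 by apply: contraNneq q1c => ->; rewrite root0.
have := IH _ us q10; rewrite Dq size_Mmonic ?monicXn ?monic_exp ?monicXsubC//.
rewrite size_exp_XsubC mupMr// mup_XsubCX eqxx.
rewrite [X in (i + X)%N](_ : _ = \sum_(d <- s) mup d q1)%N; first by lia.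
rewrite big_seq [RHS]big_seq; apply: eq_bigr => d ds.
rewrite mupMl// rootE !hornerE expf_neq0// subr_eq0.
by apply: contraNneq cs => <-.
Qed.

(** Excludes the cancellation of leading terms at a root of p of multiplicity
    mu, where nu and ga are the multiplicities of g_(n-1) and g_n, and M + 1 is
    the degree of p.  The two equations combine to
    al (M+1) y = (be - al) mu with y = ga - mu - nu, hence y > 0.  At a
    nonzero root, its be rotations bound be mu by M + 1, so al y < 1.  At the
    root zero, the exponents of p, g_(n-1) and g_n are known modulo be and give
    y = -1 modulo be, so y >= be - 1, which is too large. *)
Lemma exceptional_multiplicity_absurd (M n' al be mu nu ga : nat) :
  (0 < al < be)%N -> (0 < mu)%N ->
  (be * mu + M.+1 * (al * nu) = n' * M * (al * mu))%N ->
  (M.+1 * ga = n'.+1 * M * mu)%N ->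
  (be * mu <= M.+1)%N \/
    [/\ (mu < M.+1)%N, mu = M.+1 %[mod be], nu = n' * M %[mod be]
      & ga = n'.+1 * M %[mod be]] -> False.
Proof.
move=> /andP[al0 lt_al] mu0 Enu Ega side.
have E : (al * (M.+1 * ga) = (be - al) * mu + al * M.+1 * (mu + nu))%N.
  rewrite Ega; apply/eqP; rewrite -(eqn_add2r (al * mu)) mulnBl; apply/eqP.
  have := subnK (leq_mul (ltnW lt_al) (leqnn mu)).
  set d := (be * mu - al * mu)%N => Ed.
  have -> : (d + al * M.+1 * (mu + nu) + al * mu
     = (d + al * mu + M.+1 * (al * nu)) + al * M.+1 * mu)%N by ring.
  by rewrite Ed Enu -[n'.+1]addn1 -[M.+1]addn1; ring.
have d0 : (0 < (be - al) * mu)%N by rewrite muln_gt0 subn_gt0 lt_al.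
have lt_ga : (mu + nu < ga)%N.
  rewrite ltnNge; apply/negP => le.
  have : (al * (M.+1 * ga) <= al * M.+1 * (mu + nu))%N.
    by rewrite mulnA leq_mul2l le orbT.
  by rewrite E; lia.
have [y Ey] : exists y, ga = (y + (mu + nu))%N.
  by exists (ga - (mu + nu))%N; lia.
have {}E : (al * M.+1 * y = (be - al) * mu)%N.
  apply/eqP; rewrite -(eqn_add2r (al * M.+1 * (mu + nu))) -mulnDr -Ey -E.
  by rewrite mulnA.
have y0 : (0 < y)%N.
  by rewrite lt0n; apply: contraTneq d0 => y0; rewrite -E y0 muln0.
case: side => [le|[lt_mu Emu Emnu Emga]].
  have : (al * M.+1 * y < M.+1)%N.
    by rewrite E; apply: leq_trans le; rewrite ltn_mul2r mu0 /=; lia.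
  rewrite mulnAC -{2}[M.+1]mul1n ltn_mul2r /= ltnS leqn0 muln_eq0; lia.
have dv : (be %| y.+1)%N.
  rewrite /dvdn -(mod0n be) -(eqn_modDr (M + n' * M)).
  rewrite (_ : y.+1 + (M + n' * M) = y + (M.+1 + n' * M))%N; last by lia.
  have Em : (M.+1 + n' * M = mu + nu %[mod be])%N.
    by rewrite -modnDm -Emu -Emnu modnDm.
  by rewrite -modnDmr Em modnDmr -Ey Emga mulSn.
have {}dv : (be <= y.+1)%N by apply: dvdn_leq.
have lt1 : (al * M.+1 * y < (be - al) * M.+1)%N.
  by rewrite E ltn_mul2l subn_gt0 lt_al.
have {lt1} : (al * y < be - al)%N by move: lt1; rewrite mulnAC ltn_mul2r.
have le1 : (al * be.-1 <= al * y)%N.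
  by rewrite leq_mul2l -subn1 leq_subLR add1n dv orbT.
have le2 : (be.-1 <= al * be.-1)%N by rewrite leq_pmull.
move: (leq_trans le2 le1) al0 lt_al; clear.
move: (al * y)%N; lia.
Qed.

Lemma coef_mup0 (K : fieldType) (q : {poly K}) : q != 0 -> q`_(mup 0 q) != 0.
Proof.
move=> q0; have [i [r + Dq]] := multiplicity_XsubC q 0; rewrite q0 /= => rc.
have -> : mup 0 q = i by rewrite {1}Dq mupMr// mup_XsubCX eqxx.
by rewrite Dq subr0 coefMXn ltnn subnn -horner_coef0 -rootE.
Qed.

Lemma sum_count_undup (T : eqType) (s : seq T) :
  (\sum_(c <- undup s) count_mem c s)%N = size s.
Proof.
rewrite -sum1_size -(big_undup_iterop_count _ _ xpredT (fun=> 1%N)).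
apply: eq_bigr => c _.
by elim: (count_mem c s) => // -[|k] //= <-.
Qed.

Lemma roots_of_unity (K : numClosedFieldType) (be : nat) : (0 < be)%N ->
  exists s : seq K, [/\ uniq s, size s = be & forall z, z \in s -> z ^+ be = 1].
Proof.
move=> be0; have [s Ds] := closed_field_poly_normal ('X^be - 1 : {poly K}).
have lc1 : lead_coef ('X^be - 1 : {poly K}) = 1.
  by apply/monicP; rewrite -polyC1 monicXnsubC.
rewrite lc1 scale1r in Ds; exists s; split.
- by rewrite -separable_prod_XsubC -Ds separable_Xn_sub_1// pnatr_eq0 -lt0n.
- apply/eqP; rewrite -eqSS -(size_prod_XsubC _ id) -Ds -polyC1.
  by rewrite size_XnsubC.
- move=> z; rewrite -root_prod_XsubC -Ds rootE !hornerE subr_eq0.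
  by move/eqP.
Qed.

(** * The iterated Poisson bracket is not nilpotent *)

Section Graded.
Variables (K : idomainType) (be : nat).
Implicit Types a b : {poly K}.

(** All exponents lie in the class of r modulo be, so that
    f(z X) = z^r f for every be-th root of unity z. *)
Definition graded (r : nat) a := forall j, a`_j != 0 -> j = r %[mod be].

Lemma gradedD r a b : graded r a -> graded r b -> graded r (a + b).
Proof.
move=> ga gb j; rewrite coefD; have [->|/ga//] := eqVneq a`_j 0.
by rewrite add0r => /gb.
Qed.

Lemma gradedZ r a c : graded r a -> graded r (c *: a).
Proof. by move=> ga j; rewrite coefZ mulf_eq0 negb_or => /andP[_ /ga]. Qed.

Lemma gradedM r s a b : graded r a -> graded s b -> graded (r + s) (a * b).
Proof.
move=> ga gb j; rewrite coefM => nz.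
have [i ne] : exists i : 'I_j.+1, a`_i * b`_(j - i) != 0.
  apply/existsP; apply: contraNT nz; rewrite negb_exists => /forallP z.
  by rewrite big1// => i _; apply/eqP; have := z i; rewrite negbK.
move: ne; rewrite mulf_eq0 negb_or => /andP[/ga Ei /gb Ej].
by rewrite -modnDm -Ei -Ej modnDm subnKC// -ltnS.
Qed.

Lemma graded_deriv r a : graded r a ->
  forall j, a^`()`_j != 0 -> (j.+1 = r %[mod be])%N.
Proof.
move=> ga j; rewrite coef_deriv => nz; apply: ga.
by apply: contraNneq nz => ->; rewrite mul0rn.
Qed.

Lemma graded_deriv_pred r a : graded r.+1 a -> graded r a^`().
Proof.
move=> ga j /(graded_deriv ga) /eqP.
by rewrite -addn1 -[r.+1]addn1 eqn_modDr => /eqP.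
Qed.

Lemma gradedM_deriv r s a b :
  graded r.+1 a -> graded s b -> graded (r + s) (a * b^`()).
Proof.
move=> ga gb; have gX : graded (r.+1 + s) (a * ('X * b^`())).
  apply: gradedM => // -[|j]; rewrite coefXM ?eqxx//=.
  exact: graded_deriv.
move=> j nz; apply/eqP; rewrite -(eqn_modDr 1) !addn1 -addSn; apply/eqP.
by apply: gX; rewrite mulrCA coefXM.
Qed.

End Graded.

Section ClassicalLimit.
Variables (K : numClosedFieldType) (M n al be : nat).
Variables (p : {poly K}) (g : nat -> {poly K}) (c0 : K).
Hypotheses (n_gt0 : (0 < n)%N) (al_be : (0 < al < be)%N).
Hypotheses (p_monic : p \is monic) (size_p : size p = M.+2).
Hypothesis (p_graded : graded be M.+1 p).
Hypothesis (p_neq : p != 'X^(M.+1)).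

Let om k : int := (be * n)%:Z - (k * (be + M * al))%:Z.

Hypotheses (g0 : g 0%N = c0%:P) (c0_neq0 : c0 != 0).
Hypothesis gS : forall k, g k.+1 =
  be%:R^-1 *: ((om k)%:~R *: (p^`() * g k) + (al * M.+1)%:R *: (p * (g k)^`())).

Let al_gt0 : (0 < al)%N. Proof. by case/andP: al_be. Qed.

Let be_gt1 : (1 < be)%N. Proof. by case/andP: al_be; apply: leq_ltn_trans. Qed.

Let be_gt0 : (0 < be)%N. Proof. exact: ltnW. Qed.

Let be_neq0 : be%:R != 0 :> K.
Proof. by rewrite pnatr_eq0 -lt0n. Qed.

Let p_neq0 : p != 0. Proof. exact: monic_neq0. Qed.

Let top_p : has_top p M.+1 1.
Proof. by split; rewrite ?size_p// -(monicP p_monic) lead_coefE size_p. Qed.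

Let top_step k W c : has_top (g k) W c ->
  has_top ('X * g k.+1) (M.+1 + W)
    (be%:R^-1 * ((om k)%:~R * M.+1%:R + (al * M.+1)%:R * W%:R) * c).
Proof.
move=> tg.
have := has_topZ be%:R^-1 (has_topD
  (has_topZ (om k)%:~R (has_topM (has_top_euler top_p) tg))
  (has_topZ (al * M.+1)%:R (has_topM top_p (has_top_euler tg)))).
congr has_top; rewrite ?gS -?mul_polyC; ring.
Qed.

(** The top coefficient of g (k+1) is, up to a nonzero factor, n - k times
    that of g k: this is where the degree n of theta enters. *)
Let om_top k : (om k)%:~R * M.+1%:R + (al * M.+1)%:R * (k * M)%:R
  = M.+1%:R * be%:R * (n%:R - k%:R) :> K.
Proof.
by rewrite /om rmorphB /= -!pmulrn !natrM !natrD !natrM -[M.+1]addn1 natrD; ring.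
Qed.

Let top_g k : exists2 c, has_top (g k) (k * M) c & (k <= n)%N -> c != 0.
Proof.
elim: k => [|k [c tg nz]].
  by exists c0; rewrite // g0 mul0n; split; rewrite ?coefC// size_polyC leq_b1.
exists (be%:R^-1 * ((om k)%:~R * M.+1%:R + (al * M.+1)%:R * (k * M)%:R) * c).
  by apply/has_topX; rewrite mulSn -addSn; apply: top_step.
have N_neq0 : M.+1%:R != 0 :> K by rewrite pnatr_eq0.
move=> lt_kn; rewrite om_top !mulf_neq0 ?invr_eq0 ?nz 1?ltnW//.
by rewrite subr_eq0 eqr_nat gtn_eqF.
Qed.

Let size_g k : (size (g k) <= (k * M).+1)%N.
Proof. by have [c [] ] := top_g k. Qed.

Let g_neq0 k : (k <= n)%N -> g k != 0.
Proof.
move=> le_kn; have [c [_ e] /(_ le_kn)] := top_g k.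
by apply: contraNneq => g_0; rewrite -e g_0 coef0.
Qed.

Let graded_g k : graded be (k * M) (g k).
Proof.
elim: k => [|k IH].
  by move=> [|j]; rewrite g0 coefC mul0n //= eqxx.
rewrite gS; apply/gradedZ/gradedD; apply: gradedZ.
  by rewrite mulSn; apply: gradedM => //; apply: graded_deriv_pred.
by rewrite mulSn; apply: gradedM_deriv.
Qed.

(** Up to index n the top coefficient does not vanish.  Conversely, comparing
    leading coefficients in the equation for g (m+1) = 0 gives
    al deg (g m) = - om m, and deg (g m) <= m M then forces m <= n. *)
Let first_zero m : g m != 0 -> g m.+1 = 0 -> m = n.
Proof.
move=> gm gm1.
have le_nm : (n <= m)%N.
  by rewrite leqNgt; apply/negP => /g_neq0; rewrite gm1 eqxx.
have [d size_gm] : exists d, size (g m) = d.+1.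
  by exists (size (g m)).-1; rewrite prednK// size_poly_gt0.
have tg : has_top (g m) d (lead_coef (g m)).
  by split; rewrite ?size_gm// lead_coefE size_gm.
have [_] := top_step tg; rewrite gm1 mulr0 coef0 => /esym/eqP.
rewrite !mulf_eq0 invr_eq0 (negPf be_neq0) lead_coef_eq0 (negPf gm) orbF /=.
rewrite (_ : _ + _ = M.+1%:R * (om m + (al * d)%:Z)%:~R); last first.
  by rewrite [X in _ = _ * X]intrD -[((al * d)%N)%:~R]pmulrn !natrM; ring.
rewrite mulf_eq0 pnatr_eq0 /= intr_eq0 /om => /eqP E.
have := size_g m; rewrite size_gm ltnS => le_d.
have : (al * d <= al * (m * M))%N by rewrite leq_mul2l le_d orbT.
have : (m * (be + M * al) = m * be + al * (m * M))%N by ring.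
have : (be * n <= be * m)%N by rewrite leq_mul2l le_nm orbT.
move: E gS => /= E _.
move=> l1 e2 l3.
have e : (be * n = be * m)%N by lia.
by apply/eqP; rewrite eqn_leq le_nm andbT -(@leq_pmul2l be)// ?e//; lia.
Qed.

Let rs := sval (closed_field_poly_normal p).

Let Dp : p = \prod_(z <- rs) ('X - z%:P).
Proof.
rewrite /rs; case: closed_field_poly_normal => /= s.
by rewrite (monicP p_monic) scale1r.
Qed.

Let size_rs : size rs = M.+1.
Proof. by apply/eqP; rewrite -eqSS -size_p Dp size_prod_XsubC. Qed.

Let mu_count c : mup c p = count_mem c rs.
Proof. by rewrite {1}Dp mu_prod_XsubC. Qed.

Let root_p c : (0 < mup c p)%N = (c \in rs).
Proof. by rewrite mu_count -has_count has_pred1. Qed.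

(** Rotation by a be-th root of unity multiplies p by a constant, so it
    permutes the roots of p with their multiplicities. *)
Let rotate_p z : z ^+ be = 1 -> p \Po (z *: 'X) = z ^+ M.+1 *: p.
Proof.
move=> zb; rewrite comp_polyE -[in RHS](coefK p) poly_def scaler_sumr.
apply: eq_bigr => i _; rewrite exprZn !scalerA mulrC.
have [->|/p_graded Ei] := eqVneq p`_i 0; first by rewrite !mulr0.
by rewrite -(expr_mod i zb) Ei expr_mod.
Qed.

Let mup_rotate z c : z ^+ be = 1 -> (mup c p <= mup (z * c) p)%N.
Proof.
move=> zb.
have z0 : z != 0.
  have: z ^+ be != 0 by rewrite zb oner_eq0.
  by apply: contraNneq => ->; rewrite expf_eq0 eqxx be_gt0.
have zVb : (z^-1) ^+ be = 1 by rewrite exprVn zb invr1.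
rewrite mup_geq//; have : ('X - c%:P) ^+ mup c p %| p by rewrite -mup_geq.
case/dvdpP => q Dq; have := rotate_p zVb; rewrite {1}Dq comp_polyM => E.
rewrite -(@dvdpZr _ (z^-1 ^+ M.+1)) ?expf_neq0 ?invr_eq0// -E.
rewrite dvdp_mull// rmorphXn /= comp_polyB comp_polyX comp_polyC.
rewrite (_ : z^-1 *: 'X - c%:P = z^-1 *: ('X - (z * c)%:P)).
  by rewrite exprZn dvdpZr ?expf_neq0 ?invr_eq0.
rewrite scalerBr -!mul_polyC -polyCM mulrA mulVf// mul1r//.
Qed.

Let mult_bound c : c != 0 -> (be * mup c p <= M.+1)%N.
Proof.
move=> c_neq0; have [s [us ss sP]] := roots_of_unity K be_gt0.
have us' : uniq [seq z * c | z <- s] by rewrite map_inj_uniq//; exact: mulIf.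
have := sum_mup_le us' p_neq0; rewrite size_p ltnS; apply: leq_trans.
rewrite big_map -{1}ss (_ : _ * _ = \sum_(z <- s) mup c p)%N; last first.
  by rewrite big_const_seq count_predT iter_addn_0 mulnC.
by rewrite big_seq [leqRHS]big_seq; apply: leq_sum => z /sP /mup_rotate.
Qed.

Let zero_mult_bound : (mup 0 p < M.+1)%N.
Proof.
rewrite ltn_neqAle; apply/andP; split; last first.
  by have /= := @sum_mup_le _ [:: 0] _ isT p_neq0; rewrite big_seq1 size_p.
apply: contraNneq p_neq => e; have : ('X - 0%:P) ^+ M.+1 %| p.
  by rewrite -mup_geq// e.
rewrite subr0 => /dvdp_size_eqp; rewrite size_p size_polyXn eqxx => dv.
by rewrite eq_sym -eqp_monic ?monicXn.
Qed.

Let zero_mult_mod : mup 0 p = M.+1 %[mod be].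
Proof. exact/p_graded/coef_mup0. Qed.

(** Here p is the symbol of L, of degree N = M + 1, and g k the symbol of
    the k-th iterated commutator of L with a polynomial of degree n. *)
Lemma bracket_iterates_neq0 k : g k != 0.
Proof.
apply/eqP => gk0; have ex0 : exists k, g k == 0 by exists k; apply/eqP.
case: (ex_minnP ex0) => -[|m] /eqP gm1 minm.
  by move: gm1; rewrite g0 => /eqP; rewrite polyC_eq0 (negPf c0_neq0).
have gm : g m != 0 by apply/negP => /minm; rewrite ltnn.
have En := first_zero gm gm1; rewrite {m minm}En in gm gm1.
pose n' := n.-1; have En : n'.+1 = n by rewrite prednK.
have q0 : g n' != 0 by rewrite g_neq0// -En.
have gaE c : (M.+1 * mup c (g n) = n'.+1 * M * mup c p)%N.
  apply/eqP/negPn/negP => ne.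
  have w0 : (om n)%:~R * (mup c p)%:R + (al * M.+1)%:R * (mup c (g n))%:R != 0 :> K.
    rewrite (_ : _ + _ =
      al%:R * ((M.+1 * mup c (g n))%:R - (n'.+1 * M * mup c p)%:R)).
      by rewrite mulf_neq0 ?pnatr_eq0 ?subr_eq0 ?eqr_nat// -lt0n.
    rewrite /om En rmorphB /= -!pmulrn !natrM !natrD !natrM -[M.+1]addn1 natrD.
    by ring.
  have [/eqP[]] := mup_bracket p_neq0 gm w0.
  apply: (scalerI (a := be%:R^-1)); rewrite ?invr_eq0//.
  by rewrite -gS gm1 scaler0.
have nuE c : c \in rs -> ((mup c (g n)).+1 = mup c p + mup c (g n'))%N.
  rewrite -root_p => mu_gt0.
  have [w0|] := eqVneq ((om n')%:~R * (mup c p)%:R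
                        + (al * M.+1)%:R * (mup c (g n'))%:R : K) 0.
    have Enu : (be * mup c p + M.+1 * (al * mup c (g n'))
                 = n' * M * (al * mup c p))%N.
      apply/eqP; rewrite -(eqr_nat K) -subr_eq0 -[X in _ == X]w0; apply/eqP.
      rewrite /om -En rmorphB /= -!pmulrn !natrD !natrM !natrD !natrM.
      by rewrite -[M.+1]addn1 -[n'.+1]addn1 !natrD; ring.
    exfalso; apply: (exceptional_multiplicity_absurd al_be mu_gt0 Enu (gaE c)).
    have [c0E|/mult_bound] := eqVneq c 0; [right|by left].
    rewrite c0E; split.
    - exact: zero_mult_bound.
    - exact: zero_mult_mod.
    - exact/graded_g/coef_mup0.
    - by rewrite En; apply/graded_g/coef_mup0.
  move=> /(mup_bracket p_neq0 q0)[_ <-]; congr (_.+1).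
  have := gS n'; rewrite En => ->.
  by rewrite -[be%:R^-1 *: _]mul_polyC mupMr// rootC invr_eq0.
have sum_mu : (\sum_(c <- undup rs) mup c p = M.+1)%N.
  by under eq_bigr do rewrite mu_count; rewrite sum_count_undup.
(* Adding up nuE and gaE over the distinct roots and comparing with the
   degree bound for g n' leaves room for at most one root. *)
have h1 : (size (undup rs) <= 1)%N.
  have := sum_mup_le (undup_uniq rs) q0.
  move=> /leq_trans/(_ (size_g n')); rewrite ltnS => le.
  have : (M.+1 * \sum_(c <- undup rs) mup c (g n')
          + M.+1 * \sum_(c <- undup rs) mup c p
          = n'.+1 * M * \sum_(c <- undup rs) mup c p
            + M.+1 * size (undup rs))%N.
    rewrite -mulnDr -big_split /= -sum1_size !big_distrr /= -big_split /=.
    rewrite big_seq [RHS]big_seq; apply: eq_bigr => c; rewrite mem_undup => cr.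
    by rewrite addnC -addnC -[X in (M.+1 * X)%N]addnC -nuE// mulnS gaE muln1 addnC.
  rewrite sum_mu => E.
  have {}E : (\sum_(c <- undup rs) mup c (g n') + M.+1
           = n'.+1 * M + size (undup rs))%N.
    move/eqP: E; rewrite [(_ * M.+1)%N in X in _ == X]mulnC -!mulnDr.
    by rewrite eqn_pmul2l// => /eqP.
  move: E le; rewrite mulSn; move: (n' * M)%N (\sum_(_ <- _) _)%N (size _) => a b h; clear; lia.
have [c c_rs c_neq0] : exists2 c, c \in rs & c != 0.
  apply/hasP; apply: contraNT p_neq; rewrite -all_predC => /allP rs0.
  rewrite Dp big_seq (eq_bigr (fun=> 'X)); last first.
    by move=> z /rs0 /=; rewrite negbK => /eqP->; rewrite subr0.
  by rewrite -big_seq big_const_seq count_predT size_rs iter_mulr_1.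
have [s [us ss sP]] := roots_of_unity K be_gt0.
have [z zs z1] : exists2 z, z \in s & z != 1.
  apply/hasP; rewrite -[has _ _]negbK -all_predC; apply/negP => /allP s1.
  have : (size s <= size [:: (1%R : K)])%N.
    by apply: uniq_leq_size => // z /s1 /=; rewrite negbK inE.
  by rewrite ss leqNgt be_gt1.
have zc_rs : z * c \in rs.
  by rewrite -root_p (leq_trans _ (mup_rotate c (sP z zs)))// root_p.
have : (size [:: c; (z * c)%R] <= size (undup rs))%N.
  apply: uniq_leq_size => [|y].
    by rewrite /= inE andbT eq_sym -subr_eq0 -{2}[c]mul1r -mulrBl mulf_neq0// subr_eq0.
  by rewrite !inE mem_undup => /orP[]/eqP->.
by rewrite /= leqNgt ltnS h1.
Qed.
End ClassicalLimit.

(** * Formal power series *)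

(** A record instead of the function type itself, which already carries a
    pointwise product. *)
Record fps (R : Type) := Fps { fcoef : nat -> R }.

HB.instance Definition _ (R : Type) := gen_eqMixin (fps R).
HB.instance Definition _ (R : Type) := gen_choiceMixin (fps R).

Lemma fpsP (R : Type) (u v : fps R) :
  (forall n, fcoef u n = fcoef v n) -> u = v.
Proof. by case: u v => u [v] /= /funext ->. Qed.

Section FpsRing.
Variable R : comNzRingType.
Implicit Types u v w : fps R.

Definition fps_zero : fps R := Fps (fun=> 0).
Definition fps_opp u := Fps (fun n => - fcoef u n).
Definition fps_add u v := Fps (fun n => fcoef u n + fcoef v n).

Fact fps_addA : associative fps_add.
Proof. by move=> u v w; apply: fpsP => n /=; rewrite addrA. Qed.
Fact fps_addC : commutative fps_add.
Proof. by move=> u v; apply: fpsP => n /=; rewrite addrC. Qed.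
Fact fps_add0 : left_id fps_zero fps_add.
Proof. by move=> u; apply: fpsP => n /=; rewrite add0r. Qed.
Fact fps_addN : left_inverse fps_zero fps_opp fps_add.
Proof. by move=> u; apply: fpsP => n /=; rewrite addNr. Qed.

HB.instance Definition _ :=
  GRing.isZmodule.Build (fps R) fps_addA fps_addC fps_add0 fps_addN.

Definition fpsC (c : R) : fps R := Fps (fun n => if n == 0%N then c else 0).
Definition fps_mul u v : fps R :=
  Fps (fun n => \sum_(i < n.+1) fcoef u i * fcoef v (n - i)).

Definition fps_trunc m u : {poly R} := \poly_(i < m) fcoef u i.

(** A coefficient of a product only involves finitely many coefficients, so
    ring identities are inherited from truncations to polynomials. *)
Lemma fps_mul_trunc m n u v : (n < m)%N ->
  fcoef (fps_mul u v) n = (fps_trunc m u * fps_trunc m v)`_n.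
Proof.
move=> lt_nm; rewrite coefM; apply: eq_bigr => i _.
have lt_im : (i < m)%N by apply: leq_ltn_trans lt_nm; rewrite -ltnS.
have lt_nim : (n - i < m)%N by apply: leq_ltn_trans lt_nm; rewrite leq_subr.
by rewrite !coef_poly lt_im lt_nim.
Qed.

Let coef_trunc_mul m n (p : {poly R}) u v : (n < m)%N ->
  (fps_trunc m (fps_mul u v) * p)`_n = (fps_trunc m u * fps_trunc m v * p)`_n.
Proof.
move=> lt_nm; rewrite !coefM; apply: eq_bigr => i _.
have lt_im : (i < m)%N by apply: leq_ltn_trans lt_nm; rewrite -ltnS.
by rewrite coef_poly lt_im -fps_mul_trunc.
Qed.

Fact fps_mulC : commutative fps_mul.
Proof.
by move=> u v; apply: fpsP => n; rewrite !(@fps_mul_trunc n.+1)// mulrC.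
Qed.
Fact fps_mulA : associative fps_mul.
Proof.
move=> u v w; apply: fpsP => n; rewrite [fps_mul u _]fps_mulC.
rewrite !(@fps_mul_trunc n.+1)// !coef_trunc_mul//.
by congr (_`_n); rewrite mulrC mulrA.
Qed.
Fact fps_mul1 : left_id (fpsC 1) fps_mul.
Proof.
move=> u; apply: fpsP => n /=; rewrite big_ord_recl /= mul1r subn0.
by rewrite big1 ?addr0// => i _; rewrite mul0r.
Qed.
Fact fps_mulD : left_distributive fps_mul fps_add.
Proof.
move=> u v w; apply: fpsP => n /=; rewrite -big_split /=.
by apply: eq_bigr => i _; rewrite mulrDl.
Qed.
Fact fps_oner_neq0 : fpsC 1 != 0.
Proof.
by apply/eqP => /(congr1 (fun u => fcoef u 0)) /eqP /=; rewrite oner_eq0.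
Qed.

HB.instance Definition _ := GRing.Zmodule_isComNzRing.Build (fps R)
  fps_mulA fps_mulC fps_mul1 fps_mulD fps_oner_neq0.

Lemma fcoef0 n : fcoef (0 : fps R) n = 0. Proof. by []. Qed.
Lemma fcoefD u v n : fcoef (u + v) n = fcoef u n + fcoef v n. Proof. by []. Qed.
Lemma fcoefM u v n :
  fcoef (u * v) n = \sum_(i < n.+1) fcoef u i * fcoef v (n - i).
Proof. by []. Qed.
Lemma fcoef_trunc m n u v : (n < m)%N ->
  fcoef (u * v) n = (fps_trunc m u * fps_trunc m v)`_n.
Proof. exact: fps_mul_trunc. Qed.
Lemma fcoefMn u k n : fcoef (u *+ k) n = fcoef u n *+ k.
Proof. by elim: k => // k IH; rewrite !mulrS fcoefD IH. Qed.
Lemma fcoef_sum I (r : seq I) (P : pred I) (F : I -> fps R) n :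
  fcoef (\sum_(i <- r | P i) F i) n = \sum_(i <- r | P i) fcoef (F i) n.
Proof. exact: (big_morph (fun u => fcoef u n) (fun u v => fcoefD u v n)). Qed.

Lemma fcoefCM c u n : fcoef (fpsC c * u) n = c * fcoef u n.
Proof.
rewrite fcoefM big_ord_recl /= subn0 big1 ?addr0// => i _.
by rewrite mul0r.
Qed.

Lemma fcoef_low a b u v :
  (forall j, (j < a)%N -> fcoef u j = 0) ->
  (forall j, (j < b)%N -> fcoef v j = 0) ->
  (forall j, (j < a + b)%N -> fcoef (u * v) j = 0) /\
  fcoef (u * v) (a + b) = fcoef u a * fcoef v b.
Proof.
move=> u0 v0; split=> [j lt_j|].
  rewrite fcoefM big1// => i _; have [/u0->|le_ai] := ltnP i a.
    by rewrite mul0r.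
  by rewrite v0 ?mulr0//; have := ltn_ord i; lia.
have lt_a : (a < (a + b).+1)%N by rewrite ltnS leq_addr.
rewrite fcoefM (bigD1 (Ordinal lt_a)) //= addKn big1 ?addr0// => i.
rewrite -val_eqE /= => ne; have [/u0->|le_ai] := ltnP i a.
  by rewrite mul0r.
by rewrite v0 ?mulr0//; have := ltn_ord i; lia.
Qed.

Definition fder u : fps R := Fps (fun n => fcoef u n.+1 *+ n.+1).

Fact fder_is_additive : {morph fder : u v / u - v}.
Proof. by move=> u v; apply: fpsP => n /=; rewrite mulrnBl. Qed.
HB.instance Definition _ := GRing.isZmodMorphism.Build _ _ fder fder_is_additive.

Lemma fderM u v : fder (u * v) = fder u * v + u * fder v.
Proof.
apply: fpsP => n; rewrite fcoefD !(@fcoef_trunc n.+2)//.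
rewrite [LHS](_ : _ = fcoef (u * v) n.+1 *+ n.+1)//.
rewrite (@fcoef_trunc n.+2)// -coef_deriv derivM.
have low (w t : fps R) :
    ((fps_trunc n.+2 w)^`() * fps_trunc n.+2 t)`_n
      = (fps_trunc n.+2 (fder w) * fps_trunc n.+2 t)`_n.
  rewrite !coefM; apply: eq_bigr => i _.
  have lt_i : (i.+1 < n.+2)%N by rewrite ltnS ltn_ord.
  by rewrite coef_deriv !coef_poly lt_i (ltnW lt_i).
rewrite coefD low; congr (_ + _).
by rewrite mulrC low mulrC.
Qed.

Lemma iter_fder k u n : fcoef (iter k fder u) n = fcoef u (n + k) *+ (n + k) ^_ k.
Proof.
elim: k n => [|k IH] n; first by rewrite addn0 ffactn0.
by rewrite /= IH -mulrnA ffactnSr addSnnS -addSnnS addnK.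
Qed.

End FpsRing.

(** * Differential operators over a differential ring *)

Section Operators.
Variables (F : comNzRingType) (d : {additive F -> F}).
Hypothesis dM : forall a b, d (a * b) = d a * b + a * d b.
Implicit Types (A B C : {poly F}) (a u v : F).

(** A polynomial A over F stands for the differential operator
    sum_i A_i d^i. *)
Definition opact A u : F := \sum_(i < size A) A`_i * iter i d u.

(** Leibniz rule for full symbols: A o B = sum_l (1/l!) (d/dX)^l A . d^l B.
    In this form the commutator starts with the Poisson bracket, at l = 1. *)
Definition opcomp A B : {poly F} :=
  \sum_(l < size A) A^`N(l) * iter l (map_poly d) B.

Definition opcomm A B : {poly F} := opcomp A B - opcomp B A.

Lemma opact_wide m A u : (size A <= m)%N -> opact A u = \sum_(i < m) A`_i * iter i d u.
Proof.
move=> le_Am; rewrite /opact (big_ord_widen m (fun i => A`_i * iter i d u))//.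
rewrite big_mkcond; apply: eq_bigr => i _; case: ltnP => // le_iA.
by rewrite nth_default// mul0r.
Qed.

Lemma opcomp_wide m A B : (size A <= m)%N ->
  opcomp A B = \sum_(l < m) A^`N(l) * iter l (map_poly d) B.
Proof.
move=> le_Am; rewrite /opcomp.
rewrite (big_ord_widen m (fun l => A^`N(l) * iter l (map_poly d) B))//.
rewrite big_mkcond; apply: eq_bigr => i _; case: ltnP => // le_iA.
by rewrite nderivn_poly0// mul0r.
Qed.

Lemma iter_d0 i : iter i d 0 = 0.
Proof. by elim: i => //= i ->; rewrite raddf0. Qed.

Lemma iter_dD i u v : iter i d (u + v) = iter i d u + iter i d v.
Proof. by elim: i => //= i ->; rewrite raddfD. Qed.

Lemma opact_r0 A : opact A 0 = 0.
Proof. by rewrite /opact big1// => i _; rewrite iter_d0 mulr0. Qed.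

Lemma opact_rD A u v : opact A (u + v) = opact A u + opact A v.
Proof.
by rewrite /opact -big_split; apply: eq_bigr => i _; rewrite iter_dD mulrDr.
Qed.

Lemma opact_rB A u v : opact A (u - v) = opact A u - opact A v.
Proof.
apply/eqP; rewrite eq_sym subr_eq; apply/eqP.
by rewrite -opact_rD subrK.
Qed.

Lemma opact_rMn A u n : opact A (u *+ n) = opact A u *+ n.
Proof. by elim: n => [|n IH]; rewrite ?mulr0n ?opact_r0// !mulrS opact_rD IH. Qed.

Lemma opact_r_sum A I (r : seq I) (P : pred I) (G : I -> F) :
  opact A (\sum_(i <- r | P i) G i) = \sum_(i <- r | P i) opact A (G i).
Proof. exact: (big_morph (opact A) (opact_rD A) (opact_r0 A)). Qed.

Lemma opact_const A c u : d c = 0 -> opact A (c * u) = c * opact A u.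
Proof.
move=> dc; rewrite /opact mulr_sumr; apply: eq_bigr => i _.
rewrite mulrCA; congr (_ * _).
by elim: (val i) => //= k ->; rewrite dM dc mul0r add0r.
Qed.

Lemma opact_l0 u : opact 0 u = 0.
Proof. by rewrite /opact size_poly0 big_ord0. Qed.

Lemma opact_C c u : opact c%:P u = c * u.
Proof.
by rewrite (@opact_wide 1) ?size_polyC ?leq_b1// big_ord_recl big_ord0 coefC addr0.
Qed.

Lemma opact_lD A B u : opact (A + B) u = opact A u + opact B u.
Proof.
pose m := maxn (size A) (size B).
rewrite !(@opact_wide m) ?leq_maxl ?leq_maxr ?size_polyD// -big_split /=.
by apply: eq_bigr => i _; rewrite coefD mulrDl.
Qed.

Lemma opact_lN A u : opact (- A) u = - opact A u.
Proof. by apply/eqP; rewrite -addr_eq0 -opact_lD addNr opact_l0. Qed.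

Lemma opact_lB A B u : opact (A - B) u = opact A u - opact B u.
Proof. by rewrite opact_lD opact_lN. Qed.

Lemma opact_lZ c A u : opact (c *: A) u = c * opact A u.
Proof.
rewrite (@opact_wide (size A)) ?size_scale_leq// /opact mulr_sumr.
by apply: eq_bigr => i _; rewrite coefZ mulrA.
Qed.

Lemma opact_MX A u : opact (A * 'X) u = opact A (d u).
Proof.
rewrite (@opact_wide (size A).+1); last first.
  by apply: leq_trans (size_polyMleq _ _) _; rewrite size_polyX addnC.
rewrite big_ord_recl coefMX mul0r add0r; apply: eq_bigr => i _.
by rewrite coefMX /= -iterSr.
Qed.

Lemma d_opact B u : d (opact B u) = opact (map_poly d B + B * 'X) u.
Proof.
rewrite opact_lD opact_MX (@opact_wide (size B) (map_poly d B)); last first.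
  exact: size_poly.
rewrite /opact raddf_sum -big_split /=; apply: eq_bigr => i _.
by rewrite dM coef_map_id0 ?raddf0// -iterS iterSr.
Qed.

(** Composition after A d + c, in terms of d o B = B' + B d; the induction
    that identifies the Leibniz formula with composition rests on it. *)
Lemma opcompMXaddC A c B :
  opcomp (A * 'X + c%:P) B = c *: B + opcomp A (map_poly d B + B * 'X).
Proof.
have DX l C : iter l (map_poly d) (C * 'X) = iter l (map_poly d) C * 'X.
  elim: l => //= l ->; apply/polyP => i; rewrite coefMX !coef_map_id0 ?raddf0//.
  by rewrite coefMX; case: eqP; rewrite ?raddf0// coef_map_id0 ?raddf0.
have DD l C C' : iter l (map_poly d) (C + C')
    = iter l (map_poly d) C + iter l (map_poly d) C'.
  elim: l => //= l ->; apply/polyP => i.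
  by rewrite coefD !coef_map_id0 ?raddf0// coefD raddfD.
pose m := (size A).+1.
rewrite (@opcomp_wide m.+1); last first.
  apply: leq_trans (size_polyD _ _) _; rewrite geq_max size_polyC.
  rewrite (leq_trans (leq_b1 _))// andbT.
  apply: leq_trans (size_polyMleq _ _) _; rewrite size_polyX addnC /= leqW//.
have -> : opcomp A (map_poly d B + B * 'X)
    = opcomp A (map_poly d B) + opcomp A (B * 'X).
  by rewrite /opcomp -big_split; apply: eq_bigr => l _; rewrite DD mulrDr.
rewrite (@opcomp_wide m A (map_poly d B)) ?leqnSn//.
rewrite (@opcomp_wide m.+1 A (B * 'X)); last by rewrite ltnW.
rewrite [LHS]big_ord_recl [X in _ + (_ + X)]big_ord_recl !nderivn0 mulrDl mul_polyC /=.
under eq_bigr do rewrite /bump /= add1n add0n nderivnMXaddC mulrDl -iterS iterSr.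
rewrite big_split /= -addrA addrCA; congr (_ + _); rewrite addrCA; congr (_ + _).
rewrite -mulrA ['X * B]mulrC; congr (_ + _).
by apply: eq_bigr => i _; rewrite /bump /= add1n add0n -!iterS -iterSr DX mulrA mulrAC.
Qed.

Lemma opact_opcomp A B u : opact (opcomp A B) u = opact A (opact B u).
Proof.
elim/poly_ind: A B => [|A c IH] B.
  by rewrite /opcomp size_poly0 big_ord0 !opact_l0.
rewrite opcompMXaddC !opact_lD opact_lZ IH opact_C opact_MX addrC; congr (_ + _).
by rewrite -d_opact.
Qed.

Lemma opact_opcomm A B u :
  opact (opcomm A B) u = opact A (opact B u) - opact B (opact A u).
Proof. by rewrite opact_lB !opact_opcomp. Qed.

Lemma opcommE m A B : (size A <= m.+1)%N -> (size B <= m.+1)%N ->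
  opcomm A B = \sum_(l < m) (A^`N(l.+1) * iter l.+1 (map_poly d) B
                             - B^`N(l.+1) * iter l.+1 (map_poly d) A).
Proof.
move=> sA sB; rewrite /opcomm !(@opcomp_wide m.+1)// !big_ord_recl !nderivn0 /=.
rewrite [B * A]mulrC opprD addrACA subrr add0r -sumrB.
by apply: eq_bigr => l _.
Qed.

End Operators.

(** * Nilpotency of ad L on theta *)

Section AdNilpotent.
Variables (A : comNzRingType) (f : A).

(** Commutator of an operator with multiplication by f. *)
Definition adm (C : A -> A) : A -> A := fun u => C (f * u) - f * C u.

(** If C commutes with L and L Psi = f Psi, then
    (L - f) (C Psi) = C (f Psi) - f C Psi = [C, f] Psi, and [C, f] commutes
    with L again. *)
Lemma iter_eigen_adm (L : A -> A) (C : A -> A) (Psi : A) (k : nat) :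
  {morph L : u v / u - v} -> (forall u, L (f * u) = f * L u) ->
  (forall u, L (C u) = C (L u)) -> L Psi = f * Psi ->
  iter k (fun u => L u - f * u) (C Psi) = iter k adm C Psi.
Proof.
move=> LB Lf LC LPsi; elim: k C LC => // k IH C LC.
rewrite !iterSr -IH; last first.
  by move=> u; rewrite /adm LB Lf !LC Lf.
by congr iter; rewrite /adm LC LPsi.
Qed.

Lemma iter_admD k (C D : A -> A) :
  iter k adm (fun u => C u + D u) = fun u => iter k adm C u + iter k adm D u.
Proof.
elim: k C D => // k IH C D; rewrite !iterSr -IH; congr iter.
by apply/funext => u; rewrite /adm; ring.
Qed.

Lemma iter_admZ k a (C : A -> A) :
  iter k adm (fun u => a * C u) = fun u => a * iter k adm C u.
Proof.
elim: k C => // k IH C; rewrite !iterSr -IH; congr iter.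
by apply/funext => u; rewrite /adm; ring.
Qed.

Lemma iter_adm0 k : iter k adm (fun=> 0) = fun=> 0.
Proof.
elim: k => // k IH; rewrite iterSr -[RHS]IH; congr iter.
by apply/funext => u; rewrite /adm mulr0 subr0.
Qed.

Lemma iter_adm_ge j k C : (j <= k)%N ->
  iter j adm C = (fun=> 0) -> iter k adm C = (fun=> 0).
Proof. by move=> /subnK <- E; rewrite iterD E iter_adm0. Qed.

Variable d : {additive A -> A}.
Hypothesis dM : forall a b, d (a * b) = d a * b + a * d b.

(** [d o C, f] = d o [C, f] + d(f) C, so composing with d raises the order of
    nilpotency by one. *)
Lemma iter_adm_der k C : iter k adm C = (fun=> 0) ->
  iter k.+1 adm (fun u => d (C u)) = (fun=> 0).
Proof.
elim: k C => [|k IH] C E.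
  rewrite /= in E *; apply/funext => u.
  by rewrite /adm E raddf0 mulr0 subr0.
rewrite iterSr in E; rewrite iterSr.
rewrite (_ : adm _ = fun u => d (adm C u) + d f * C u); last first.
  by apply/funext => u; rewrite /adm raddfB dM; ring.
rewrite iter_admD (IH _ E) iter_admZ iterSr E.
by apply/funext => u; rewrite mulr0 addr0.
Qed.

Lemma iter_adm_diffop M (c : nat -> A) :
  iter M.+1 adm (fun u => \sum_(j < M.+1) c j * iter j d u) = (fun=> 0).
Proof.
have der j : iter j.+1 adm (iter j d) = (fun=> 0).
  elim: j => [|j IH]; last exact: iter_adm_der.
  by apply/funext => u; rewrite /= /adm subrr.
suff H m k : (m <= k)%N ->
    iter k adm (fun u => \sum_(j < m) c j * iter j d u) = (fun=> 0) by exact: H.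
elim: m => [|m IH] le_mk.
  rewrite (_ : (fun=> _) = (fun=> 0)) ?iter_adm0//.
  by apply/funext => u; rewrite big_ord0.
rewrite (_ : (fun=> _) =
  (fun u => \sum_(j < m) c j * iter j d u + c m * iter m d u)); last first.
  by apply/funext => u; rewrite big_ord_recr.
rewrite iter_admD IH ?(ltnW le_mk)// iter_admZ (iter_adm_ge le_mk (der m)).
by apply/funext => u; rewrite mulr0 addr0.
Qed.

End AdNilpotent.

Section KernelBound.
Variable K : numFieldType.

(** Infinitely many natural numbers would be too many roots. *)
Lemma nat_roots_bounded (p : {poly K}) : p != 0 ->
  exists J, forall e, (J <= e)%N -> p.[e%:R] != 0.
Proof.
move=> p0; apply: contrapT => /forallNP noJ.
have ex J : exists e, (J <= e)%N /\ p.[e%:R] = 0.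
  have /existsNP[e /not_implyP[le /negP]] := noJ J.
  by rewrite negbK => /eqP; exists e.
have ser n : exists s : seq nat,
    [/\ uniq s, size s = n & all (fun e => root p e%:R) s].
  elim: n => [|n [s [us ss rs]]]; first by exists [::].
  have [e [le_e pe]] := ex (\max_(i <- s) i).+1%N.
  exists (e :: s); split; rewrite /= ?us ?ss ?rs ?rootE ?pe ?eqxx// andbT.
  apply: contraL le_e => es; rewrite -leqNgt.
  exact: (@leq_bigmax_seq _ s xpredT id e es isT).
have [s [us ss rs]] := ser (size p).
have us' : uniq [seq (e%:R : K) | e <- s].
  by rewrite map_inj_uniq// => i j /eqP; rewrite eqr_nat => /eqP.
have: (size s < size p)%N.
  by have := max_poly_roots p0 _ us'; rewrite size_map; apply; rewrite all_map.
by rewrite ss ltnn.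
Qed.

(** X (X - 1) ... (X - j + 1), whose value at e is the factor produced by the
    j-th derivative of t^e. *)
Definition falling (j : nat) : {poly K} := \prod_(i < j) ('X - (i%:R)%:P).

Lemma falling_top j : has_top (falling j) j 1.
Proof.
elim: j => [|j IH].
  by rewrite /falling big_ord0; split; rewrite ?size_poly1 ?coef1.
rewrite /falling big_ord_recr /= -addn1 -[X in has_top _ _ X]mulr1.
apply: has_topM => //; split; first by rewrite size_XsubC.
by rewrite coefB coefX coefC subr0.
Qed.

Lemma falling_ffact j e : (falling j).[e%:R] = (e ^_ j)%:R.
Proof.
elim: j => [|j IH]; first by rewrite /falling big_ord0 hornerC ffactn0.
rewrite /falling big_ord_recr /= hornerM -/(falling j) IH ffactnSr natrM !hornerE.
have [le_je|lt_ej] := leqP j e; first by rewrite natrB.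
by rewrite ffact_small// !mul0r.
Qed.

(** The solutions of B u = 0 in power series form a finite-dimensional space,
    by the method of Frobenius: if u starts with u_e t^e, the lowest
    coefficient of B u is chi(e) u_e, where chi is the indicial polynomial,
    and chi(e) is nonzero for e large. *)
Lemma kernel_order_bound (B : {poly fps K}) : B != 0 ->
  exists J, forall u, (forall j, (j < J)%N -> fcoef u j = 0) ->
    opact (@fder K) B u = 0 -> u = 0.
Proof.
move=> B0; set r := size B.
pose P v := [exists j : 'I_r, (r <= v + j)%N && (fcoef B`_j (v + j - r) != 0)].
have exP : exists v, P v.
  have r0 : (r.-1 < r)%N by rewrite prednK// size_poly_gt0.
  have [i Bi] : exists i, fcoef (lead_coef B) i != 0.
    apply: contrapT => /forallNP z.
    have : lead_coef B != 0 by rewrite lead_coef_eq0.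
    apply/negP; rewrite negbK; apply/eqP/fpsP => i.
    by apply/eqP; have /negP := z i; rewrite negbK.
  exists i.+1; apply/existsP; exists (Ordinal r0) => /=.
  rewrite addSnnS prednK ?(leq_ltn_trans _ r0)// leq_addl addnK.
  by move: Bi; rewrite lead_coefE.
case: (ex_minnP exP) => v Pv min_v.
(* With weight 1 for t and -1 for the derivation, v - r is the least weight of a
   term of B, and be j t^(v + j - r) is what B_j contributes to it. *)
pose be j := if (r <= v + j)%N then fcoef B`_j (v + j - r) else 0.
have low j i : (j < r)%N -> (i < v + j - r)%N -> fcoef B`_j i = 0.
  move=> lt_jr lt_i; apply/eqP/negPn/negP => ne.
  have := min_v (i + r - j)%N; rewrite leqNgt => /(_ _)/negP; apply; last by lia.
  apply/existsP; exists (Ordinal lt_jr) => /=.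
  rewrite (_ : (i + r - j + j) = i + r)%N; last by lia.
  by rewrite leq_addl addnK.
pose chi : {poly K} := \sum_(j < r) be j *: falling j.
have chi0 : chi != 0.
  case/existsP: Pv => jv Pjv.
  have exj : exists j, (j < r)%N && (be j != 0).
    by exists jv; rewrite ltn_ord /be; case/andP: Pjv => -> ->.
  have bj j : (j < r)%N && (be j != 0) -> (j <= r)%N by case/andP => /ltnW.
  case: (ex_maxnP exj bj) => j0 /andP[lt_j0 be0] max_j0.
  apply: contraNneq be0 => chi0.
  have := congr1 (fun q : {poly K} => q`_j0) chi0; rewrite coef0 coef_sum.
  rewrite (bigD1 (Ordinal lt_j0)) //= coefZ (falling_top j0).2 mulr1 big1 ?addr0//.
    by move=> ->.
  move=> j; rewrite -val_eqE /= coefZ => ne.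
  have [lt_j|le_j] := ltnP j j0.
    by rewrite nth_default ?mulr0//; apply: leq_trans (falling_top j).1 _.
  have [->|bej] := eqVneq (be j) 0; first by rewrite mul0r.
  by have := max_j0 j; rewrite ltn_ord bej => /(_ isT); lia.
have [J HJ] := nat_roots_bounded chi0.
exists (maxn J r) => u u0 Bu; apply: contrapT => une.
have exe : exists e, fcoef u e != 0.
  apply: contrapT => /forallNP z; apply: une; apply: fpsP => e.
  by apply/eqP; have /negP := z e; rewrite negbK.
case: (ex_minnP exe) => e ue min_e.
have lt_e i : (i < e)%N -> fcoef u i = 0.
  move=> lt_ie; apply/eqP/negPn/negP => /min_e; lia.
have : (maxn J r <= e)%N by rewrite leqNgt; apply: contraNN ue => /u0 ->.
rewrite geq_max => /andP[/HJ chie le_re].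
have : fcoef (opact (@fder K) B u) (e + v - r) = chi.[e%:R] * fcoef u e.
  rewrite /opact fcoef_sum horner_sum mulr_suml; apply: eq_bigr => j _.
  have lt_jr : (j < r)%N := ltn_ord j.
  have lowu i : (i < e - j)%N -> fcoef (iter j (@fder K) u) i = 0.
    by move=> lt_i; rewrite iter_fder lt_e ?mul0rn//; lia.
  have [z tz] := fcoef_low (fun i => @low j i (ltn_ord j)) lowu.
  rewrite hornerZ falling_ffact /be; case: leqP => [le_r|lt_r].
    rewrite (_ : (e + v - r = v + j - r + (e - j))%N); last first.
      by move: (nat_of_ord j) lt_jr le_re le_r; clear => k; move: r; clear; lia.
    rewrite tz iter_fder subnK; last exact: leq_trans (ltnW lt_jr) le_re.
    by rewrite -[fcoef u e *+ _]mulr_natl mulrA.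
  rewrite !mul0r z//; move: (nat_of_ord j) lt_jr le_re lt_r; clear => k.
  by move: r; clear; lia.
rewrite Bu fcoef0 => /esym/eqP; rewrite mulf_eq0 (negPf chie) /=.
by rewrite (negPf ue).
Qed.

End KernelBound.

Lemma fder_const (R : comNzRingType) (c : R) : fder (fpsC c) = 0.
Proof. by apply: fpsP => n; rewrite /= mul0rn. Qed.

Lemma fpsCM (R : comNzRingType) (c d : R) : fpsC c * fpsC d = fpsC (c * d).
Proof. by apply: fpsP => -[|n]; rewrite fcoefCM /= ?mulr0. Qed.

Lemma opact_fpsC (R : comNzRingType) (P : {poly fps R}) (c : R) u :
  opact (@fder R) P (fpsC c * u) = fpsC c * opact (@fder R) P u.
Proof. exact: (opact_const (@fderM R) _ _ (fder_const c)). Qed.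

Section Annihilator.
Variables (K : numFieldType) (L B : {poly fps K}) (Psi : fps (fps K)).
Variable f : nat -> K.
Notation d := (@fder K).
Hypothesis LPsi : forall j,
  opact d L (fcoef Psi j) = \sum_(i < j.+1) fpsC (f i) * fcoef Psi (j - i).
Hypothesis BPsi : forall j, opact d B (fcoef Psi j) = 0.
Hypothesis Psi0 : fcoef Psi 0 != 0.
Variable k : nat.
Hypotheses (k_gt0 : (0 < k)%N) (fk : f k != 0).
Hypothesis f_low : forall i, (0 < i < k)%N -> f i = 0.

Let T (u : fps K) := opact d L u - fpsC (f 0) * u.

Let TD u v : T (u + v) = T u + T v.
Proof. by rewrite /T opact_rD mulrDr opprD addrACA. Qed.

Let T0 : T 0 = 0.
Proof. by rewrite /T opact_r0 mulr0 subr0. Qed.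

Let TC c u : T (fpsC c * u) = fpsC c * T u.
Proof.
by rewrite /T opact_fpsC mulrBr; congr (_ - _); ring.
Qed.

Let iterT_sum i n (a : nat -> K) (u : nat -> fps K) :
  iter i T (\sum_(j < n) fpsC (a j) * u j)
    = \sum_(j < n) fpsC (a j) * iter i T (u j).
Proof.
elim: i => //= i ->; rewrite (big_morph T TD T0).
by apply: eq_bigr => j _; rewrite TC.
Qed.

Let g : fps (fps K) := Fps (fun i => if i == 0%N then 0 else fpsC (f i)).

(** T acts on the expansion of Psi in the second variable as multiplication by
    g = f - f_0, whose powers have known order of vanishing. *)
Let TPsi i j : iter i T (fcoef Psi j) = fcoef (g ^+ i * Psi) j.
Proof.
elim: i j => [|i IH] j; first by rewrite expr0 mul1r.
rewrite exprS -mulrA iterS IH.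
have Tg (U : fps (fps K)) : (forall j, T (fcoef U j) = fcoef (g * U) j) ->
    forall j, T (fcoef (g * U) j) = fcoef (g * (g * U)) j.
  move=> TU m; rewrite [fcoef (g * U) m]fcoefM (big_morph T TD T0).
  rewrite fcoefM; apply: eq_bigr => -[[|l] /= _] _; first by rewrite !mul0r T0.
  by rewrite TC TU.
elim: i j {IH} => [|i IH] j; last first.
  by rewrite exprS -mulrA; apply: Tg => m; apply: IH.
rewrite expr0 mul1r /T LPsi fcoefM !big_ord_recl /= subn0 mul0r add0r.
by rewrite addrAC subrr add0r.
Qed.

Let g_low i : (forall j, (j < i * k)%N -> fcoef (g ^+ i) j = 0) /\
  fcoef (g ^+ i) (i * k) = fpsC (f k ^+ i).
Proof.
elim: i => [|i [low top]]; first by split.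
have glow j : (j < k)%N -> fcoef g j = 0.
  move=> lt_jk /=; case: eqP => // /eqP; rewrite -lt0n => j0.
  rewrite f_low ?j0//; apply: fpsP => n /=; by rewrite if_same.
have [z t] := fcoef_low glow low; rewrite exprS mulSn; split=> //.
by rewrite t top /= gtn_eqF// fpsCM exprS.
Qed.

Let iterT_low i j : (j < i * k)%N -> iter i T (fcoef Psi j) = 0.
Proof.
move=> lt_j; rewrite TPsi.
have no j' : (j' < 0)%N -> fcoef Psi j' = 0 by [].
by have [z _] := fcoef_low (g_low i).1 no; rewrite z// addn0.
Qed.

Let iterT_top i : iter i T (fcoef Psi (i * k)) = fpsC (f k ^+ i) * fcoef Psi 0.
Proof.
rewrite TPsi; have no j' : (j' < 0)%N -> fcoef Psi j' = 0 by [].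
have [_] := fcoef_low (g_low i).1 no.
by rewrite addn0 => ->; rewrite (g_low i).2.
Qed.

Let Psi_free n (a : nat -> K) : (exists2 i, (i < n)%N & a i != 0) ->
  \sum_(i < n) fpsC (a i) * fcoef Psi (i * k) != 0.
Proof.
move=> [i lt_in ai]; have exi : exists i, (i < n)%N && (a i != 0).
  by exists i; rewrite lt_in.
have bi j : (j < n)%N && (a j != 0) -> (j <= n)%N by case/andP => /ltnW.
case: (ex_maxnP exi bi) => {lt_in ai exi bi}{}i /andP[lt_in ai] max_i.
apply/negP => /eqP /(congr1 (iter i T)).
rewrite (iterT_sum i n a (fun j => fcoef Psi (j * k))) (bigD1 (Ordinal lt_in)) //= iterT_top big1 ?addr0; last first.
  move=> j; rewrite -val_eqE /= => ne.
  have [lt_ji|le_ij] := ltnP j i.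
    by rewrite iterT_low ?mulr0// ltn_mul2r k_gt0.
  have [->|aj] := eqVneq (a j) 0.
    by rewrite (_ : fpsC 0 = 0) ?mul0r//; apply: fpsP => m /=; rewrite if_same.
  have := max_i j; rewrite ltn_ord aj => /(_ isT) le_ji.
  by move: ne; rewrite eqn_leq le_ji le_ij.
have -> : iter i T 0 = 0 by elim: (i) => //= m ->.
rewrite mulrA fpsCM => E; move/negP: Psi0; apply; apply/eqP/fpsP => m.
have := congr1 (fun u => fcoef u m) E; rewrite fcoefCM fcoef0 => /eqP.
by rewrite !mulf_eq0 expf_eq0 (negPf ai) (negPf fk) andbF => /eqP.
Qed.

(** Let k be the first positive index with f_k nonzero, and T = L - f_0.  The
    equation L Psi = f Psi gives T^i Psi_(i k) = f_k^i Psi_0 and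
    T^i Psi_j = 0 for j < i k.  So the Psi_(i k) are independent, and some
    nontrivial combination of J + 1 of them vanishes to order J; if B were
    nonzero, [kernel_order_bound] would make this combination zero. *)
Lemma annihilator_eq0 : B = 0.
Proof.
apply/eqP/negPn/negP => B0; have [J HJ] := kernel_order_bound B0.
pose C : 'M[K]_(J.+1, J) := \matrix_(i, t) fcoef (fcoef Psi (i * k)) t.
have [v vK v0] : exists2 v : 'rV[K]_J.+1, (v <= kermx C)%MS & v != 0.
  apply/rowV0Pn; rewrite -mxrank_eq0 mxrank_ker subn_eq0 -ltnNge ltnS.
  exact: rank_leq_col.
have {vK} vC : v *m C = 0 by apply/sub_kermxP.
pose a i := if insub i is Some o then v 0 (o : 'I_J.+1) else 0.
have a_ord (o : 'I_J.+1) : a o = v 0 o by rewrite /a valK.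
have : \sum_(i < J.+1) fpsC (a i) * fcoef Psi (i * k) != 0.
  apply: Psi_free; have [ix v_ix] := rV0Pn _ v0.
  by exists ix; rewrite // a_ord.
move/negP; apply; apply/eqP/HJ => [t lt_tJ|]; last first.
  rewrite opact_r_sum big1// => i _.
  by rewrite opact_fpsC BPsi mulr0.
have := congr1 (fun w : 'rV[K]_J => w 0 (Ordinal lt_tJ)) vC; rewrite !mxE => E.
rewrite fcoef_sum -[RHS]E; apply: eq_bigr => i _.
by rewrite fcoefCM a_ord mxE.
Qed.

End Annihilator.

Section FormalBispectral.
Variables (K : numFieldType) (L : {poly fps K}) (Psi : fps (fps K)).
Variables (M : nat) (A : nat -> nat -> K) (f : nat -> K) (theta : fps K).
Notation d := (@fder K).
Hypothesis LPsi : forall j,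
  opact d L (fcoef Psi j) = \sum_(i < j.+1) fpsC (f i) * fcoef Psi (j - i).
Hypothesis APsi : forall j,
  \sum_(l < M.+1) \sum_(i < j.+1)
     fpsC (A l i) * (fcoef Psi (j - i + l) *+ (j - i + l) ^_ l)
  = theta * fcoef Psi j.
Hypothesis Psi0 : fcoef Psi 0 != 0.
Hypothesis f_nonconst : exists2 k, (0 < k)%N & f k != 0.

Let lift (C : fps K -> fps K) (U : fps (fps K)) : fps (fps K) :=
  Fps (fun j => C (fcoef U j)).
Let F : fps (fps K) := Fps (fun j => fpsC (f j)).
Let Ah l : fps (fps K) := Fps (fun j => fpsC (A l j)).

Let liftB P (U V : fps (fps K)) : lift (opact d P) (U - V) = lift (opact d P) U - lift (opact d P) V.
Proof. by apply: fpsP => j; rewrite /= opact_rB. Qed.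

Let lift_const P (c : nat -> K) (U : fps (fps K)) :
  lift (opact d P) (Fps (fun j => fpsC (c j)) * U)
   = Fps (fun j => fpsC (c j)) * lift (opact d P) U.
Proof.
apply: fpsP => j; rewrite [LHS]/= [in RHS]fcoefM opact_r_sum.
apply: eq_bigr => i _ /=.
by rewrite opact_fpsC.
Qed.

Let lift_iter_fder P l (U : fps (fps K)) :
  lift (opact d P) (iter l (@fder _) U) = iter l (@fder _) (lift (opact d P) U).
Proof.
apply: fpsP => j; rewrite iter_fder -opact_rMn.
by rewrite [LHS]/= iter_fder.
Qed.

Let adB k := iter k (opcomm d L) theta%:P.

(** [L, B] Psi = L (B Psi) - B (f Psi) = (L - f) (B Psi), as f is constant for
    the derivation of the inner variable. *)
Let adB_Psi k :
  lift (opact d (adB k)) Psi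
   = iter k (fun U => lift (opact d L) U - F * U) (fpsC theta * Psi).
Proof.
elim: k => [|k IH].
  by apply: fpsP => j; rewrite fcoefCM /= opact_C.
rewrite iterS -IH; apply: fpsP => j; rewrite /= (opact_opcomm (@fderM K)) -/(adB k).
congr (_ - _); rewrite LPsi -[RHS](_ : fcoef (lift (opact d (adB k)) (F * Psi)) j = _).
  by [].
by rewrite lift_const.
Qed.

(** Psi is a power series in the second variable whose coefficients are power
    series in the first one; f and the A l only involve the second variable.
    Both ways of computing (L - f)^(m+1) (theta Psi) are compared: through
    theta Psi = Lambda Psi it is zero, and it equals ad(L)^(m+1)(theta) Psi. *)
Lemma ad_theta_eq0 : iter M.+1 (opcomm d L) theta%:P = 0.
Proof.
have exk : exists k, (0 < k)%N && (f k != 0).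
  by have [k k0 fk] := f_nonconst; exists k; rewrite k0.
case: (ex_minnP exk) => k /andP[k0 fk] min_k.
apply: (annihilator_eq0 LPsi _ Psi0 k0 fk) => [j|i /andP[i0 lt_ik]]; last first.
  by apply/eqP; apply: contraTT lt_ik => fi; rewrite -leqNgt min_k// i0.
have LP : lift (opact d L) Psi = F * Psi.
  by apply: fpsP => m; rewrite /= LPsi.
have AP : fpsC theta * Psi = \sum_(l < M.+1) Ah l * iter l (@fder _) Psi.
  apply: fpsP => m; rewrite fcoefCM -APsi fcoef_sum; apply: eq_bigr => l _.
  by rewrite fcoefM; apply: eq_bigr => i _; rewrite iter_fder.
have := adB_Psi M.+1; rewrite AP.
rewrite (@iter_eigen_adm _ F (lift (opact d L)) (fun U => \sum_(l < M.+1) Ah l * iter l (@fder _) U)).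
- rewrite (iter_adm_diffop _ (@fderM _)) => /(congr1 (fun U => fcoef U j)).
  by [].
- exact: liftB.
- exact: lift_const.
- move=> U; rewrite -[LHS]/(lift (opact d L) _).
  have -> : lift (opact d L) (\sum_(l < M.+1) Ah l * iter l (@fder _) U)
      = \sum_(l < M.+1) lift (opact d L) (Ah l * iter l (@fder _) U).
    by apply: fpsP => m; rewrite /= !fcoef_sum opact_r_sum.
  by apply: eq_bigr => l _; rewrite lift_const lift_iter_fder.
- exact: LP.
Qed.

End FormalBispectral.

(** * Top coefficients of iterated commutators *)

Section TopMore.
Variable R : comNzRingType.
Implicit Types (A : {poly R}) (c : R).

Lemma has_top0 W : has_top (0 : {poly R}) W 0.
Proof. by split; rewrite ?size_poly0 ?coef0. Qed.

Lemma has_topN A W c : has_top A W c -> has_top (- A) W (- c).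
Proof. by move=> [s <-]; split; rewrite ?size_polyN ?coefN. Qed.

Lemma has_top_sum W I (r : seq I) (P : pred I) (G : I -> {poly R}) (c : I -> R) :
  (forall i, P i -> has_top (G i) W (c i)) ->
  has_top (\sum_(i <- r | P i) G i) W (\sum_(i <- r | P i) c i).
Proof.
move=> H; elim/big_rec2: _ => [|i x y Pi]; first exact: has_top0.
by apply: has_topD; apply: H.
Qed.

Lemma has_top_weaken A V W c : (V < W)%N -> has_top A V c -> has_top A W 0.
Proof.
move=> lt [s _]; split; first by apply: leq_trans s _; rewrite ltnS ltnW.
by rewrite nth_default//; apply: leq_trans s lt.
Qed.

Lemma has_topXn_low A l V W c : (W < l + V)%N ->
  has_top ('X^l * A) W c -> has_top A V 0.
Proof. by move=> lt /(has_top_weaken lt)/has_topXn. Qed.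

Lemma has_top_nderivn A W c l :
  has_top A W c -> has_top ('X^l * A^`N(l)) W (c *+ 'C(W, l)).
Proof.
move=> [s <-]; split; last first.
  rewrite coefXnM; case: ltnP => [/bin_small->|le_lW]; first by rewrite mulr0n.
  by rewrite coef_nderivn subnKC.
apply/leq_sizeP => j ltWj; rewrite coefXnM; case: ltnP => // le_lj.
by rewrite coef_nderivn subnKC// nth_default ?mul0rn//; apply: leq_trans s ltWj.
Qed.

Lemma has_top_map (d : {additive R -> R}) A W c l :
  has_top A W c -> has_top (iter l (map_poly d) A) W (iter l d c).
Proof.
move=> [s <-]; elim: l => // l [s' e]; rewrite !iterS -e; split.
  exact: leq_trans (size_poly _ _) s'.
by rewrite coef_map_id0 ?raddf0.
Qed.

End TopMore.

Section LeadingAd.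
Variables (F : comNzRingType) (d : {additive F -> F}).
Hypothesis d1 : d 1 = 0.
Variables (M : nat) (L : {poly F}).
Hypothesis L_top : has_top L M.+1 1.

(** In the Leibniz formula only l = 1 reaches order M + W, and there the
    derivative of the leading coefficient 1 of L vanishes. *)
Lemma opcomm_top B W c : has_top B W c ->
  has_top (opcomm d L B) (M + W) (M.+1%:R * d c).
Proof.
move=> B_top; pose m := (maxn M.+1 W).+1.
have sL : (size L <= m.+1)%N.
  by apply: leq_trans L_top.1 _; rewrite /m; lia.
have sB : (size B <= m.+1)%N.
  by apply: leq_trans B_top.1 _; rewrite /m; lia.
have iterd1 l : iter l.+1 d 1 = 0.
  by elim: l => [|l IH]; rewrite ?d1// iterS IH raddf0.
pose t l := L^`N(l.+1) * iter l.+1 (map_poly d) B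
            - B^`N(l.+1) * iter l.+1 (map_poly d) L.
have tl l : has_top ('X^(l.+1) * t l) (M.+1 + W)
    (iter l.+1 d c *+ 'C(M.+1, l.+1)).
  rewrite /t mulrBr !mulrA -[X in has_top _ _ X]addr0; apply: has_topD.
    rewrite -mulr_natl.
    exact: has_topM (has_top_nderivn _ L_top) (has_top_map _ _ B_top).
  rewrite -[X in has_top _ _ X]oppr0; apply: has_topN.
  rewrite addnC -[0](mulr0 (c *+ 'C(W, l.+1))) -(iterd1 l).
  exact: has_topM (has_top_nderivn _ B_top) (has_top_map _ _ L_top).
rewrite (opcommE _ sL sB) /m big_ord_recl -[X in has_top _ _ X]addr0.
apply: has_topD.
  apply/has_topX; rewrite -addSn mulr_natl -[M.+1 in X in has_top _ _ X]bin1.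
  by rewrite -['X]expr1; exact: (tl 0%N).
have E : \sum_(i < maxn M.+1 W) (0 : F) = 0 by rewrite big1_eq.
rewrite -[X in has_top _ _ X]E; apply: has_top_sum => i _.
by apply: has_topXn_low (tl _); rewrite lift0 !addSn !ltnS leq_addl.
Qed.

Lemma iter_opcomm_top theta k :
  has_top (iter k (opcomm d L) theta%:P) (k * M) (M.+1%:R ^+ k * iter k d theta).
Proof.
elim: k => [|k IH].
  by rewrite mul0n expr0 mul1r; split; rewrite ?coefC// size_polyC leq_b1.
rewrite mulSn; have := opcomm_top IH; congr has_top.
have dn (n : nat) x : d (n%:R * x) = n%:R * d x by rewrite !mulr_natl raddfMn.
by rewrite exprS -mulrA -natrX dn.
Qed.

End LeadingAd.

Lemma theta_polynomial (K : numFieldType) (M : nat) (L : {poly fps K})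
    (theta : fps K) k :
  has_top L M.+1 1 -> iter k (opcomm (@fder K) L) theta%:P = 0 ->
  forall j, (k <= j)%N -> fcoef theta j = 0.
Proof.
move=> Lt ad0 j le_kj.
have d1 : @fder K 1 = 0 by exact: fder_const.
have [_] := iter_opcomm_top (d := @fder K) d1 Lt theta k; rewrite ad0 coef0.
move/(congr1 (fun u => fcoef u (j - k))); rewrite -natrX mulr_natl fcoefMn iter_fder.
rewrite subnK// => /esym/eqP; rewrite -mulrnA mulrn_eq0 muln_eq0 expn_eq0 /=.
by rewrite -[_ ^_ _ == _]negbK -lt0n ffact_gt0 le_kj /= => /eqP.
Qed.

(** * Growth at infinity read off a Taylor series *)

Section Taylor.
Variables (K : numFieldType) (a : K).
Implicit Types b : {poly K}.

(** Taylor series at a of a polynomial. *)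
Definition taylor b : fps K := Fps (fun n => (b \Po ('X + a%:P))`_n).

Fact taylor_is_additive : zmod_morphism taylor.
Proof. by move=> b c; apply: fpsP => n; rewrite /= comp_polyB coefB. Qed.
HB.instance Definition _ := GRing.isZmodMorphism.Build _ _ taylor taylor_is_additive.

Fact taylor_is_monoid_morphism : monoid_morphism taylor.
Proof.
split=> [|b c]; apply: fpsP => n /=; rewrite ?comp_polyM ?coefM//.
by rewrite -polyC1 comp_polyC coefC.
Qed.
HB.instance Definition _ :=
  GRing.isMonoidMorphism.Build _ _ taylor taylor_is_monoid_morphism.

Lemma taylor_inj : injective taylor.
Proof.
move=> b c E; have : b \Po ('X + a%:P) = c \Po ('X + a%:P).
  by apply/polyP => n; have := congr1 (fun u => fcoef u n) E.
move/(congr1 (comp_poly ('X - a%:P))); rewrite -!comp_polyA.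
by rewrite comp_polyD comp_polyX comp_polyC subrK !comp_polyXr.
Qed.

Lemma fder_taylor b : fder (taylor b) = taylor b^`().
Proof.
apply: fpsP => n; rewrite /= -coef_deriv deriv_comp derivD derivX derivC.
by rewrite addr0 mulr1.
Qed.

Lemma taylorC c : taylor c%:P = fpsC c.
Proof. by apply: fpsP => n; rewrite /= comp_polyC coefC. Qed.

End Taylor.

Section Valuation.
Variables (K : numFieldType) (a : K) (Q : {poly K}) (be dQ : nat).
Hypotheses (Q_monic : Q \is monic) (size_Q : size Q = dQ.+2) (be_gt0 : (0 < be)%N).
Notation taylor := (taylor a).
Implicit Types (s t : fps K) (w : int) (c : K) (b : {poly K}).

(** s is the Taylor series at a of a rational function b / Q^e, and c is its
    coefficient of order w / be at infinity, where the degree of b must be at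
    most W / be with W = w + e be deg Q.  Substituting X^be for X makes these
    weights integral; if be does not divide W, the coefficient c is zero.  The
    exponent e is arbitrary, so that a weight w may be negative. *)
Definition has_weight s w c := exists e W b,
  [/\ W%:Z = w + (e * (be * dQ.+1))%:Z,
      taylor Q ^+ e * s = taylor b & has_top (b \Po 'X^be) W c].

Lemma has_top_comp b : has_top (b \Po 'X^be) (be * (size b).-1) (lead_coef b).
Proof.
split; last by rewrite coef_comp_poly_Xn// dvdn_mulr// mulKn// lead_coefE.
apply/leq_sizeP => j lt_j; rewrite coef_comp_poly_Xn//.
case: ifP => // /dvdnP[i Ej]; rewrite Ej mulnK// nth_default//.
move: lt_j; rewrite Ej mulnC ltn_pmul2r//; exact: leq_trans (leqSpred _).
Qed.

Lemma Q_top : has_top (Q \Po 'X^be) (be * dQ.+1) 1.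
Proof. by have := has_top_comp Q; rewrite size_Q (monicP Q_monic). Qed.

Lemma has_weight_at s w c e W b e' :
  W%:Z = w + (e * (be * dQ.+1))%:Z -> taylor Q ^+ e * s = taylor b ->
  has_top (b \Po 'X^be) W c -> (e <= e')%N ->
  exists W' b', [/\ W'%:Z = w + (e' * (be * dQ.+1))%:Z,
     taylor Q ^+ e' * s = taylor b' & has_top (b' \Po 'X^be) W' c].
Proof.
move=> EW Eb tb le_ee'.
exists ((e' - e) * (be * dQ.+1) + W)%N, (Q ^+ (e' - e) * b); split.
- rewrite PoszD EW addrCA -PoszD -mulnDl subnK//.
- by rewrite -(subnK le_ee') exprD -mulrA Eb rmorphM rmorphXn addnK.
- rewrite comp_polyM -[c]mul1r; apply: has_topM => //.
  elim: (e' - e)%N => [|k IH].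
    by rewrite expr0 -polyC1 comp_polyC mul0n; split; rewrite ?coefC// size_polyC leq_b1.
  by rewrite exprS comp_polyM mulSn -[1]mulr1; apply: has_topM => //; apply: Q_top.
Qed.

Lemma has_weight_null s w : taylor Q * s = 0 -> has_weight s w 0.
Proof.
move=> Qs; exists `|w|.+1%N.
have : 0 <= w + (`|w|.+1%N * (be * dQ.+1))%:Z.
  have : (`|w|.+1 * 1 <= `|w|.+1 * (be * dQ.+1))%N.
    by rewrite leq_mul2l muln_gt0 be_gt0 orbT.
  by lia.
case: (w + _) => // W _; exists W, 0; split=> //.
  by rewrite exprSr -mulrA Qs mulr0 rmorph0.
by rewrite comp_poly0; apply: has_top0.
Qed.

Lemma has_weight0 w : has_weight 0 w 0.
Proof. by apply: has_weight_null; rewrite mulr0. Qed.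

Lemma has_weightD s t w c c' : has_weight s w c -> has_weight t w c' -> has_weight (s + t) w (c + c').
Proof.
case=> e [W [b [EW Eb tb]]] [e' [W' [b' [EW' Eb' tb']]]].
have [W1 [b1 [EW1 Eb1 tb1]]] := has_weight_at EW Eb tb (leq_addr e' e).
have [W2 [b2 [EW2 Eb2 tb2]]] := has_weight_at EW' Eb' tb' (leq_addl e e').
have EWW : W2 = W1 by apply/eqP; rewrite -eqz_nat EW1 EW2.
rewrite {}EWW in tb2; exists (e + e')%N, W1, (b1 + b2); split=> //.
  by rewrite mulrDr Eb1 Eb2 raddfD.
by rewrite comp_polyD; apply: has_topD.
Qed.

Lemma has_weightM s t w w' c c' :
  has_weight s w c -> has_weight t w' c' -> has_weight (s * t) (w + w') (c * c').
Proof.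
case=> e [W [b [EW Eb tb]]] [e' [W' [b' [EW' Eb' tb']]]].
exists (e + e')%N, (W + W')%N, (b * b'); split=> //.
- by rewrite PoszD EW EW' mulnDl PoszD addrACA.
- by rewrite exprD mulrACA Eb Eb' rmorphM.
- by rewrite comp_polyM; apply: has_topM.
Qed.

Lemma has_weight_taylor b W c : has_top (b \Po 'X^be) W c -> has_weight (taylor b) W%:Z c.
Proof.
by move=> tb; exists 0%N, W, b; split; rewrite ?mul0n ?addr0// expr0 mul1r.
Qed.

Lemma has_weightC c : has_weight (fpsC c) 0 c.
Proof.
rewrite -(taylorC a); apply: has_weight_taylor; rewrite comp_polyC.
by split; rewrite ?coefC// size_polyC leq_b1.
Qed.

Lemma has_weightZ k s w c : has_weight s w c -> has_weight (fpsC k * s) w (k * c).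
Proof. by move=> /(has_weightM (has_weightC k)); rewrite add0r. Qed.

Lemma has_weightMn s w c n : has_weight s w c -> has_weight (s *+ n) w (c *+ n).
Proof.
move=> sv; elim: n => [|n IH]; first exact: has_weight0.
by rewrite !mulrS; apply: has_weightD.
Qed.

Lemma has_weightN s w c : has_weight s w c -> has_weight (- s) w (- c).
Proof.
move=> /(has_weightZ (-1)); rewrite mulN1r; congr has_weight.
by apply: fpsP => n; rewrite fcoefCM mulN1r.
Qed.

Lemma has_weight_sum w I (r : seq I) (P : pred I) (G : I -> fps K) (c : I -> K) :
  (forall i, P i -> has_weight (G i) w (c i)) ->
  has_weight (\sum_(i <- r | P i) G i) w (\sum_(i <- r | P i) c i).
Proof.
move=> H; elim/big_rec2: _ => [|i x y Pi]; first exact: has_weight0.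
by apply: has_weightD; apply: H.
Qed.

Lemma has_weight_weaken s w w' c : w < w' -> has_weight s w c -> has_weight s w' 0.
Proof.
move=> lt [e [W [b [EW Eb tb]]]].
have : 0 <= w' + (e * (be * dQ.+1))%:Z by lia.
case EW' : (w' + _) => [W'|//] _.
exists e, W', b; split=> //; apply: has_top_weaken tb; lia.
Qed.

(** The Taylor series determines the rational function, hence its behaviour
    at infinity: this is how vanishing near a is transported to infinity. *)
Lemma has_weight_eq0 w c : has_weight 0 w c -> c = 0.
Proof.
case=> e [W [b [_ + [_ <-]]]]; rewrite mulr0 -(rmorph0 taylor) => /taylor_inj <-.
by rewrite comp_poly0 coef0.
Qed.

(** Q^(e+1) s' = Q b' - e Q' b, and c x^(w/be) has derivative
    (w/be) c x^(w/be - 1). *)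
Lemma has_weight_fder s w c : has_weight s w c ->
  has_weight (fder s) (w - be%:Z) (be%:R^-1 * (w%:~R * c)).
Proof.
case=> e [W [b [EW Eb tb]]].
have be0 : be%:R != 0 :> K by rewrite pnatr_eq0 -lt0n.
pose b' := Q * b^`() - e%:R *: (Q^`() * b).
have Eb' : taylor Q ^+ e.+1 * fder s = taylor b'.
  have : fder (taylor Q ^+ e * s) = fder (taylor b) by rewrite Eb.
  have derX : fder (taylor Q ^+ e) * taylor Q = (taylor Q ^+ e * fder (taylor Q)) *+ e.
    elim: (e) => [|k IH].
      by rewrite expr0 [fder 1](fder_const 1) mul0r.
    rewrite exprS fderM mulrDl -[in X in _ + X]mulrA IH mulrnAr mulrSr addrC.
    by congr (_ *+ _ + _); ring.
  rewrite fderM => E; rewrite /b' rmorphB -mul_polyC !rmorphM /= -!fder_taylor -E -Eb.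
  rewrite taylorC /= mulrDr [taylor Q * (_ * s)]mulrA [taylor Q * fder _]mulrC derX.
  have -> : fpsC (e%:R : K) = e%:R.
    by rewrite -(taylorC a) rmorph_nat rmorph_nat.
  by rewrite exprS -mulr_natl; ring.
have ltW : (be <= W + be * dQ.+1)%N.
  by rewrite mulnS addnCA leq_addr.
exists e.+1, (W + be * dQ.+1 - be)%N, b'; split=> //.
  rewrite -subzn// PoszD EW mulSn PoszD; ring.
apply/(has_topXn _ _ be); rewrite subnKC//.
have comp_deriv (q : {poly K}) :
    'X^be * (q^`() \Po 'X^be) = be%:R^-1 *: ('X * (q \Po 'X^be)^`()).
  rewrite deriv_comp derivXn !mulrnAr -scalerMnr scalerMnl -mulr_natr mulVf//.
  by rewrite scale1r mulrCA -exprS prednK// mulrC.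
have -> : 'X^be * (b' \Po 'X^be)
    = (Q \Po 'X^be) * (be%:R^-1 *: ('X * (b \Po 'X^be)^`()))
      - e%:R *: ((be%:R^-1 *: ('X * (Q \Po 'X^be)^`())) * (b \Po 'X^be)).
  rewrite -!comp_deriv /b' comp_polyB comp_polyZ !comp_polyM -!mul_polyC; ring.
have := has_topD (has_topM Q_top (has_topZ be%:R^-1 (has_top_euler tb)))
  (has_topN (has_topZ e%:R (has_topM (has_topZ be%:R^-1 (has_top_euler Q_top)) tb))).
rewrite addnC; congr has_top.
have -> : w%:~R = W%:R - (e * (be * dQ.+1))%:R :> K.
  by rewrite !pmulrn EW rmorphD /= addrK.
by rewrite natrM; ring.
Qed.

End Valuation.

(** * Symbols of operators and their Poisson bracket *)

Section Symbol.
Variables (K : numFieldType) (a : K) (Q : {poly K}) (al be dQ : nat).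
Hypotheses (Q_monic : Q \is monic) (size_Q : size Q = dQ.+2).
Hypothesis (al_be : (0 < al < be)%N).
Let be_gt0 : (0 < be)%N. Proof. by case/andP: al_be => ? /(leq_trans _)->. Qed.
Implicit Types (A B : {poly fps K}) (g h : {poly K}) (w : int).
Notation hv := (has_weight a Q be dQ).

(** With weight be for x and -al for the derivation, A has weight at most w,
    and its part of weight w is x^(w/be) g(eta), eta = x^(al/be) d. *)
Definition has_symbol A w g := forall j, hv A`_j (w + (al * j)%:Z) g`_j.

Lemma has_symbolM A B w w' g h :
  has_symbol A w g -> has_symbol B w' h -> has_symbol (A * B) (w + w') (g * h).
Proof.
move=> Ag Bh j; rewrite !coefM; apply: has_weight_sum => // i _.
have := has_weightM (Ag i) (Bh (j - i)%N); congr has_weight.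
by rewrite addrACA -PoszD -mulnDr subnKC// -ltnS.
Qed.

Lemma has_symbolD A B w g h :
  has_symbol A w g -> has_symbol B w h -> has_symbol (A + B) w (g + h).
Proof. by move=> Ag Bh j; rewrite !coefD; apply: has_weightD. Qed.

Lemma has_symbolN A w g : has_symbol A w g -> has_symbol (- A) w (- g).
Proof. by move=> Ag j; rewrite !coefN; apply: has_weightN. Qed.

Lemma has_symbol_sum w I (r : seq I) (P : pred I) (G : I -> {poly fps K})
    (g : I -> {poly K}) : (forall i, P i -> has_symbol (G i) w (g i)) ->
  has_symbol (\sum_(i <- r | P i) G i) w (\sum_(i <- r | P i) g i).
Proof.
move=> H; elim/big_rec2: _ => [j|i x y Pi]; first by rewrite !coef0; exact: has_weight0 Q_monic size_Q be_gt0 _.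
by apply: has_symbolD; apply: H.
Qed.

Lemma has_symbol_weaken A w w' g : w < w' -> has_symbol A w g -> has_symbol A w' 0.
Proof.
move=> lt Ag j; rewrite coef0.
have lt' : w + (al * j)%:Z < w' + (al * j)%:Z by rewrite ltrD2r.
exact: (has_weight_weaken Q_monic size_Q be_gt0 lt' (Ag j)).
Qed.

Lemma has_symbol_nderivn A w g l :
  has_symbol A w g -> has_symbol A^`N(l) (w + (al * l)%:Z) g^`N(l).
Proof.
move=> Ag j; rewrite !coef_nderivn; have := has_weightMn Q_monic size_Q be_gt0 'C(l + j, l) (Ag (l + j)%N).
by congr has_weight; rewrite -addrA -PoszD -mulnDr.
Qed.

(** Action of x d/dx on x^(w/be) g(eta), read on g. *)
Definition euler w g : {poly K} :=
  be%:R^-1 *: (w%:~R *: g + al%:R *: ('X * g^`())).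

Lemma has_symbol_fder A w g : has_symbol A w g ->
  has_symbol (map_poly (@fder K) A) (w - be%:Z) (euler w g).
Proof.
move=> Ag j; rewrite coef_map_id0 ?raddf0//.
have := has_weight_fder Q_monic size_Q be_gt0 (Ag j); rewrite addrAC; congr has_weight.
rewrite !coefZ coefD !coefZ coefXM coef_deriv; congr (_ * _).
rewrite rmorphD /= -pmulrn natrM mulrDl; congr (_ + _).
by case: (j) => [|i] /=; rewrite -mulrA ?mul0r// [_%:R * g`_ _]mulr_natl.
Qed.

Lemma has_symbol_iter_fder A w g l : has_symbol A w g ->
  exists h, has_symbol (iter l (map_poly (@fder K)) A) (w - (be * l)%:Z) h.
Proof.
move=> Ag; elim: l => [|l [h IH]]; first by exists g; rewrite muln0 subr0.
exists (euler (w - (be * l)%:Z) h); rewrite iterS mulnS PoszD opprD addrA addrAC.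
exact: has_symbol_fder.
Qed.

(** In the Leibniz formula the term of index l has weight lower by
    l (be - al).  So only the Poisson bracket, l = 1, survives at the top; in it
    the terms containing X g' h' cancel. *)
Lemma has_symbol_opcomm A B w w' g h : has_symbol A w g -> has_symbol B w' h ->
  has_symbol (opcomm (@fder K) A B) (w + w' + al%:Z - be%:Z)
    (be%:R^-1 *: (w'%:~R *: (g^`() * h) - w%:~R *: (g * h^`()))).
Proof.
move=> Ag Bh; pose m := maxn (size A) (size B).
have [sA sB] : (size A <= m.+2)%N /\ (size B <= m.+2)%N.
  by rewrite /m; split; lia.
rewrite (opcommE _ sA sB) big_ord_recl -[X in has_symbol _ _ X]addr0.
have lead C D v v' p q : has_symbol C v p -> has_symbol D v' q ->
    has_symbol (C^`N(1) * map_poly (@fder K) D) (v + v' + al%:Z - be%:Z)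
      (p^`() * euler v' q).
  move=> Cp Dq.
  have := has_symbolM (has_symbol_nderivn 1 Cp) (has_symbol_fder Dq).
  by rewrite !nderivn1 muln1; congr has_symbol; lia.
apply: has_symbolD.
  have BA := lead _ _ _ _ _ _ Bh Ag; rewrite [w' + w]addrC in BA.
  have := has_symbolD (lead _ _ _ _ _ _ Ag Bh) (has_symbolN BA).
  congr has_symbol.
  by rewrite /euler -!mul_polyC; ring.
have E : \sum_(i < m) (0 : {poly K}) = 0 by rewrite big1_eq.
rewrite -[X in has_symbol _ _ X]E; apply: has_symbol_sum => i _; rewrite lift0.
have low C D v v' p q : has_symbol C v p -> has_symbol D v' q ->
    has_symbol (C^`N(i.+2) * iter i.+2 (map_poly (@fder K)) D)
      (v + v' + al%:Z - be%:Z) 0.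
  move=> Cp Dq; have [q' Dq'] := has_symbol_iter_fder i.+2 Dq.
  apply: has_symbol_weaken (has_symbolM (has_symbol_nderivn i.+2 Cp) Dq').
  have : (al * i.+1 < be * i.+1)%N by rewrite ltn_pmul2r//; case/andP: al_be.
  by rewrite ![(_ * i.+2)%N]mulnS; lia.
rewrite -[0](subr0 0); apply: has_symbolD; first exact: low Ag Bh.
by apply: has_symbolN; rewrite [w + w']addrC; apply: low Bh Ag.
Qed.

Lemma has_symbol0_eq0 w g : has_symbol 0 w g -> g = 0.
Proof. by move=> H; apply/polyP => j; have := H j; rewrite !coef0 => /has_weight_eq0. Qed.

End Symbol.

(** * The theorem for formal power series *)

(** The minimal ratio D i / i in lowest terms; it is less than one because it
    is at i0. *)
Lemma minimal_slope (N : nat) (ok : pred nat) (D : nat -> nat) (i0 : nat) :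
  (forall i, ok i -> 0 < D i)%N -> ok i0 -> (D i0 < i0 <= N)%N ->
  exists i al be, [/\ (0 < i <= N)%N, ok i & (be * D i = al * i)%N] /\
    [/\ (0 < al < be)%N, coprime al be
      & forall j, (0 < j <= N)%N -> ok j -> (al * j <= be * D j)%N].
Proof.
move=> D0 ok0 /andP[Di0 le_i0].
pose P (i : 'I_N.+1) := (0 < i)%N && ok i.
have Pi0 : P (inord i0) by rewrite /P inordK// ok0 andbT (leq_ltn_trans _ Di0).
case: (@arg_minP _ rat _ _ P (fun i => (D i)%:R / i%:R) Pi0) => i /andP[i_gt0 oki] mini.
have cross j : (0 < j <= N)%N -> ok j -> (D i * j <= D j * i)%N.
  move=> /andP[j0 le_jN] okj; have := mini (inord j); rewrite /P inordK// j0 okj.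
  move=> /(_ isT); rewrite ler_pdivrMr ?ltr0n// mulrAC ler_pdivlMr ?ltr0n//.
  by rewrite -!natrM ler_nat.
have i0_gt0 : (0 < i0)%N by apply: leq_ltn_trans Di0.
have Di_lt : (D i < i)%N.
  have c := cross i0; rewrite i0_gt0 le_i0 in c; have {}c := c isT ok0.
  have : (D i0 * i < i0 * i)%N by rewrite ltn_pmul2r.
  by move=> /(leq_ltn_trans c); rewrite [(i0 * i)%N]mulnC ltn_pmul2r.
pose g := gcdn (D i) i.
have g0 : (0 < g)%N by rewrite gcdn_gt0 i_gt0 orbT.
have Eal : (D i %/ g * g = D i)%N by rewrite divnK// dvdn_gcdl.
have Ebe : (i %/ g * g = i)%N by rewrite divnK// dvdn_gcdr.
exists i, (D i %/ g)%N, (i %/ g)%N; split; split=> //.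
- by rewrite i_gt0 /= -ltnS.
- by apply/eqP; rewrite -(eqn_pmul2r g0) mulnAC Ebe mulnAC Eal mulnC.
- rewrite divn_gt0// dvdn_leq ?dvdn_gcdl ?D0//=.
  by rewrite -(ltn_pmul2r g0) Eal Ebe.
- by rewrite /coprime -(eqn_pmul2r g0) muln_gcdl Eal Ebe mul1n.
- move=> j jN okj; rewrite -(leq_pmul2r g0) mulnAC Eal mulnAC Ebe.
  by rewrite [(i * _)%N]mulnC; apply: cross.
Qed.

Section FormalTheorem.
Variables (K : numClosedFieldType) (a : K) (M : nat).
Variables (v : nat -> fps K) (P Qd : nat -> {poly K}).
Let N := M.+1.
Hypothesis vN : v N = 1.
Hypothesis v_rat : forall k, (k < N)%N ->
  [/\ Qd k \is monic, taylor a (Qd k) * v k = taylor a (P k)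
    & (size (P k) < size (Qd k))%N].
Variables (Psi : fps (fps K)).
Variables (m : nat) (A : nat -> nat -> K) (f : nat -> K) (theta : fps K).
Let L : {poly fps K} := \poly_(i < N.+1) v i.
Hypothesis LPsi : forall j,
  opact (@fder K) L (fcoef Psi j) = \sum_(i < j.+1) fpsC (f i) * fcoef Psi (j - i).
Hypothesis APsi : forall j,
  \sum_(l < m.+1) \sum_(i < j.+1)
     fpsC (A l i) * (fcoef Psi (j - i + l) *+ (j - i + l) ^_ l)
  = theta * fcoef Psi j.
Hypothesis Psi0 : fcoef Psi 0 != 0.
Hypothesis f_nonconst : exists2 k, (0 < k)%N & f k != 0.
Hypothesis theta_nonconst : exists2 k, (0 < k)%N & fcoef theta k != 0.

Let L_top : has_top L N 1.
Proof. by split; rewrite ?size_poly// coef_poly ltnSn vN. Qed.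

Let ad0 : iter m.+1 (opcomm (@fder K) L) theta%:P = 0.
Proof. exact: ad_theta_eq0 LPsi APsi Psi0 f_nonconst. Qed.

Let theta_poly be (be_gt0 : (0 < be)%N) : exists n b c, [/\ (0 < n)%N, c != 0,
  theta = taylor a b & has_top (b \Po 'X^be) (be * n) c].
Proof.
have [k k0 tk] := theta_nonconst.
have bnd j : fcoef theta j != 0 -> (j <= m.+1)%N.
  apply: contraR; rewrite -ltnNge => /ltnW lt.
  by apply/eqP; apply: (theta_polynomial L_top ad0).
have ext : exists j, fcoef theta j != 0 by exists k.
case: (ex_maxnP ext bnd) => n tn max_n.
pose q := \poly_(i < n.+1) fcoef theta i.
have size_q : size q = n.+1 by rewrite size_poly_eq.
have lead_q : lead_coef q = fcoef theta n by rewrite lead_coefE size_q coef_poly ltnSn.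
have size_b : size (q \Po ('X - a%:P)) = n.+1.
  by rewrite size_comp_poly2 ?size_XsubC.
exists n, (q \Po ('X - a%:P)), (fcoef theta n); split=> //.
- exact: leq_trans k0 (max_n k tk).
- apply: fpsP => j; rewrite /= -comp_polyA comp_polyB comp_polyX comp_polyC.
  rewrite addrK comp_polyXr coef_poly; case: ltnP => // lt_nj.
  by apply/eqP/negPn/negP => /max_n; rewrite leqNgt lt_nj.
have := has_top_comp be_gt0 (q \Po ('X - a%:P)); rewrite size_b /=.
by rewrite lead_coef_comp ?size_XsubC// lead_q lead_coefXsubC expr1n mulr1.
Qed.

(** The coefficients v k of L are Taylor series at a of the rational functions
    P k / Qd k, and the conclusion bounds their degrees at infinity.  If it
    failed, L would have the symbol p below, other than X^N, and the vanishing of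
    ad(L)^(m+1)(theta) would contradict [bracket_iterates_neq0]. *)
Lemma formal_regular_singular k : (k < N)%N -> P k != 0 ->
  (size (P k) + (N - k) <= size (Qd k))%N.
Proof.
move=> lt_kN Pk; rewrite leqNgt; apply/negP => bad.
pose D i := (size (Qd (N - i)) - size (P (N - i)))%N.
pose ok i := (0 < i <= N)%N && (P (N - i) != 0).
have D_gt0 i : ok i -> (0 < D i)%N.
  move=> /andP[/andP[i0 iN] _]; rewrite subn_gt0.
  by have [|] := @v_rat (N - i)%N; first by rewrite ltn_subrL i0.
have ok_k : ok (N - k)%N by rewrite /ok subn_gt0 lt_kN leq_subr subKn ?Pk// ltnW.
have Dk : (D (N - k) < N - k <= N)%N.
  rewrite leq_subr andbT /D subKn; last exact: ltnW.
  by have [_ _ lt] := v_rat lt_kN; rewrite ltn_subLR ?(ltnW lt).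
have [i [al [be [[iN oki Ei] [al_be cop le_slope]]]]] := minimal_slope D_gt0 ok_k Dk.
have be_gt0 : (0 < be)%N by case/andP: al_be => ? /(leq_trans _)->.
pose pc j := if j == N then 1 else
  if ok (N - j)%N && (be * D (N - j) == al * (N - j))%N then lead_coef (P j) else 0.
pose p : {poly K} := \poly_(j < N.+1) pc j.
have pE j : p`_j = if (j <= N)%N then pc j else 0 by rewrite coef_poly ltnS.
have size_p : size p = N.+1 by rewrite size_poly_eq// /pc eqxx oner_neq0.
have p_monic : p \is monic.
  by rewrite monicE lead_coefE size_p pE leqnn /pc eqxx.
have p_graded : graded be N p.
  move=> j; rewrite pE /pc; case: leqP => [le_jN|]; last by rewrite eqxx.
  case: (j =P N) => [->//|_]; case: ifP => [/andP[_ /eqP E] _|]; last by rewrite eqxx.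
  have : (be %| N - j)%N.
    by rewrite -(@Gauss_dvdr _ al) 1?coprime_sym// -E dvdn_mulr.
  by rewrite -(eqn_mod_dvd be le_jN) => /eqP ->.
have p_neq : p != 'X^N.
  case/andP: iN => i0 le_iN.
  have ne : (N - i == N)%N = false by rewrite ltn_eqF// ltn_subrL i0.
  apply/eqP => /(congr1 (fun q : {poly K} => q`_(N - i)))/eqP.
  rewrite pE leq_subr coefXn ne /pc ne subKn// oki Ei eqxx lead_coef_eq0.
  by case/andP: oki => _ /negPf ->.
(* a common denominator; the factor X makes its degree positive *)
pose R := \prod_(l < N) Qd l; pose Q := 'X * R.
have R_monic : R \is monic by apply: monic_prod => l _; have [] := v_rat (ltn_ord l).
have Q_monic : Q \is monic by rewrite rpredM ?monicX.
pose dQ := (size R).-1.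
have size_R : size R = dQ.+1 by rewrite prednK// size_poly_gt0 monic_neq0.
have size_Q : size Q = dQ.+2.
  by rewrite /Q mulrC size_mulX ?monic_neq0// size_R.
pose hv := has_weight a Q be dQ.
have hv_v l : (l < N)%N -> hv (v l) (- (be * D (N - l)%N)%:Z) (lead_coef (P l)).
  move=> lt_lN; have [Ql El lt] := v_rat lt_lN.
  have [Rl [Rl_monic DQ]] : exists Rl, Rl \is monic /\ Q = Rl * Qd l.
    exists ('X * \prod_(j < N | j != Ordinal lt_lN) Qd j); split; last first.
      by rewrite /Q /R (bigD1 (Ordinal lt_lN)) //=; ring.
    by rewrite rpredM ?monicX// monic_prod// => j _; have [] := v_rat (ltn_ord j).
  have EQ : taylor a Q * v l = taylor a (Rl * P l).
    by rewrite DQ !rmorphM -mulrA El.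
  have [P0|P0] := eqVneq (P l) 0.
    by rewrite P0 lead_coef0; apply: has_weight_null => //; rewrite EQ P0 mulr0 rmorph0.
  have := has_top_comp be_gt0 (Rl * P l).
  rewrite lead_coef_monicM// => tb.
  exists 1%N, (be * (size (Rl * P l)%R).-1)%N, (Rl * P l); split=> //.
  have sPl : (0 < size (P l))%N by rewrite size_poly_gt0.
  have sRl : (0 < size Rl)%N by rewrite size_poly_gt0 monic_neq0.
  have := size_Q; rewrite DQ size_Mmonic ?monic_neq0// => sQ.
  rewrite mul1n /D subKn; last exact: ltnW.
  have Esz : ((size (Rl * P l)%R).-1 + (size (Qd l) - size (P l)) = dQ.+1)%N.
    rewrite size_proper_mul ?(monicP Rl_monic) ?mul1r ?lead_coef_eq0//.
    move: sQ lt sPl sRl; clear; lia.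
  by rewrite -Esz mulnDr PoszD [RHS]addrC addrK.
have L_symbol : has_symbol a Q al be dQ L (- (al * N)%:Z) p.
  move=> j; rewrite pE coef_poly ltnS; case: leqP => [le_jN|lt_Nj]; last first.
    exact: has_weight0.
  rewrite /pc; case: (eqVneq j N) => [->|ne].
    by rewrite vN addrC subrr; apply: (@has_weightC _ a Q be dQ 1).
  have lt_jN : (j < N)%N by rewrite ltn_neqAle ne.
  have Ej : - (al * N)%:Z + (al * j)%:Z = - (al * (N - j))%:Z.
    by rewrite mulnBr -subzn ?leq_mul2l ?le_jN ?orbT// opprB addrC.
  rewrite Ej; have hj := hv_v j lt_jN.
  have [P0|P0] := eqVneq (P j) 0.
    rewrite {1}/ok subKn// P0 eqxx andbF.
    apply: has_weight_null => //.
    have [_ E _] := v_rat lt_jN; rewrite P0 rmorph0 in E.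
    rewrite /Q /R (bigD1 (Ordinal lt_jN)) //= [Qd j * _]mulrC mulrA rmorphM /=.
    by rewrite -mulrA E mulr0.
  have okj : ok (N - j)%N by rewrite /ok subn_gt0 lt_jN leq_subr subKn.
  have rng : (0 < N - j <= N)%N by rewrite subn_gt0 lt_jN leq_subr.
  rewrite okj /=; have := le_slope _ rng okj; rewrite leq_eqVlt eq_sym.
  case: eqP => /= [Eq _|_ lt]; first by rewrite -Eq.
  by apply: (has_weight_weaken Q_monic size_Q be_gt0 _ hj); rewrite ltrN2.
have [n [b [c [n0 c0 Eth tb]]]] := theta_poly be_gt0.
pose om l : int := (be * n)%:Z - (l * (be + M * al))%:Z.
pose g := fix g l := if l is l'.+1 then
   be%:R^-1 *: ((om l')%:~R *: (p^`() * g l') + (al * N)%:R *: (p * (g l')^`()))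
   else c%:P.
have ad_symbol l :
    has_symbol a Q al be dQ (iter l (opcomm (@fder K) L) theta%:P) (om l) (g l).
  elim: l => [|l IH].
    move=> j; rewrite /= !coefC /om mul0n subr0; case: eqP => [->|_].
      by rewrite muln0 addr0 Eth; apply: has_weight_taylor.
    exact: has_weight0.
  rewrite iterS; have := has_symbol_opcomm Q_monic size_Q al_be L_symbol IH.
  congr has_symbol; first by rewrite /om mulSn /N; nia.
  rewrite [g l.+1]/=; congr (_ *: (_ + _)).
  by rewrite rmorphN /= scaleNr opprK.
have g_neq0 := bracket_iterates_neq0 n0 al_be p_monic size_p p_graded p_neq
  (erefl : g 0%N = c%:P) c0 (fun l => erefl).
have := ad_symbol m.+1; rewrite ad0 => /has_symbol0_eq0 /eqP.
by rewrite (negPf (g_neq0 _)).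
Qed.

End FormalTheorem.

(** * Convergent series *)

Local Open Scope classical_set_scope.
Local Open Scope ring_scope.

Section Sums.
Variable K : numFieldType.
Implicit Types (u v : nat -> K) (l x a e : K).

Definition sums u l := \sum_(i < n) u i @[n --> \oo] --> l.

Lemma sumsP u l : sums u l <->
  forall e, 0 < e -> exists N, forall n, (N <= n)%N -> `|l - \sum_(i < n) u i| < e.
Proof.
rewrite /sums; split=> [/cvgrPdist_lt H e e0|H].
  by have [N _ HN] := H e e0; exists N => n /HN.
by apply/cvgrPdist_lt => e e0; have [N HN] := H e e0; exists N.
Qed.

Lemma sums_unique u l l' : sums u l -> sums u l' -> l = l'.
Proof. by move=> ul ul'; apply: cvg_unique ul ul'; exact: norm_hausdorff. Qed.

Lemma real_le_eps x y : x \is Num.real -> y \is Num.real ->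
  (forall e, 0 < e -> x < y + e) -> x <= y.
Proof.
move=> xr yr H; rewrite real_leNgt//; apply/negP => lt_yx.
by have := H (x - y); rewrite subr_gt0 addrC subrK ltxx => /(_ lt_yx).
Qed.

Lemma sums_le (s : nat -> K) l a B N : B \is Num.real ->
  s @ \oo --> l -> (forall n, (N <= n)%N -> `|s n - a| <= B) -> `|l - a| <= B.
Proof.
move=> Br /cvgrPdist_lt sl H; apply: real_le_eps => // e e0.
have [N' _ HN] := sl e e0; set n := maxn N N'.
have -> : l - a = (s n - a) + (l - s n) by ring.
apply: le_lt_trans (ler_normD _ _) _; apply: ler_ltD.
  by apply: H; rewrite leq_maxl.
by apply: HN; rewrite /= leq_maxr.
Qed.

Lemma sums_bounded u l : sums u l -> exists C, forall i, `|u i| <= C.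
Proof.
move=> /sumsP/(_ 1 ltr01)[N HN].
exists (2 + \sum_(i < N) `|u i|) => i.
have s0 n : 0 <= \sum_(i < n) `|u i| by apply: sumr_ge0.
have [lt_iN|le_Ni] := ltnP i N.
  rewrite (bigD1 (Ordinal lt_iN)) //= addrCA lerDl addr_ge0// sumr_ge0//.
have -> : u i = (l - \sum_(j < i) u j) - (l - \sum_(j < i.+1) u j).
  by rewrite big_ord_recr /=; ring.
apply: le_trans (ler_normB _ _) _.
rewrite -[leLHS]addr0 lerD ?s0// ltW// -[2]/(1 + 1) ltrD ?HN//; exact: leqW.
Qed.

(** The only form of completeness of the field that is used. *)
Definition abs_complete := forall u,
  (exists M, forall n, \sum_(i < n) `|u i| <= M) -> exists l, sums u l.

Lemma sumsD u v l l' : sums u l -> sums v l' -> sums (fun i => u i + v i) (l + l').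
Proof.
move=> ul vl; rewrite /sums.
rewrite (_ : (fun n => _) = (fun n => \sum_(i < n) u i + \sum_(i < n) v i)).
  exact: cvgD ul vl.
by apply/funext => n; rewrite big_split.
Qed.

Lemma sumsZ k u l : sums u l -> sums (fun i => k * u i) (k * l).
Proof.
move=> ul; rewrite /sums.
rewrite (_ : (fun n => _) = (fun n => k * \sum_(i < n) u i)).
  by apply: cvgM => //; exact: cvg_cst.
by apply/funext => n; rewrite mulr_sumr.
Qed.

Lemma sums_norm_le u l B : B \is Num.real ->
  sums u l -> (forall n, \sum_(i < n) `|u i| <= B) -> `|l| <= B.
Proof.
move=> Br ul H; rewrite -[l]subr0.
apply: (sums_le (N := 0%N) Br ul) => n _; rewrite subr0.
exact: le_trans (ler_norm_sum _ _ _) (H n).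
Qed.

Lemma geometric_bound n : \sum_(i < n) (2^-1 : K) ^+ i <= 2.
Proof.
have -> : \sum_(i < n) (2^-1 : K) ^+ i = 2 - 2 * 2^-1 ^+ n.
  elim: n => [|n IH]; first by rewrite big_ord0 expr0 mulr1 subrr.
  by rewrite big_ord_recr /= IH exprS; move: (2^-1 ^+ n) => h; field.
by rewrite lerBlDr lerDl mulr_ge0// exprn_ge0// invr_ge0.
Qed.

Lemma square_geometric_bound n : \sum_(i < n) i%:R ^+ 2 * (2^-1 : K) ^+ i <= 6.
Proof.
have -> : \sum_(i < n) i%:R ^+ 2 * (2^-1 : K) ^+ i
    = 6 - (2 * n%:R ^+ 2 + 4 * n%:R + 6) * 2^-1 ^+ n.
  elim: n => [|n IH]; first by rewrite big_ord0 expr0; ring.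
  by rewrite big_ord_recr /= IH [2^-1 ^+ n.+1]exprS -natr1; move: (2^-1 ^+ n) => h; field.
by rewrite lerBlDr lerDl mulr_ge0// ?exprn_ge0 ?invr_ge0.
Qed.

End Sums.

(** * Power series: asymptotics and derivatives *)

Section PowerSeries.
Variable K : numFieldType.
Hypothesis Kcomplete : abs_complete K.
Implicit Types (f g : K -> K) (u v : fps K) (a x t : K).

Definition power_series f a u := exists2 s : K, 0 < s &
  (exists C, forall i, `|fcoef u i| * s ^+ i <= C) /\
  forall x, `|x - a| < s -> sums (fun i => fcoef u i * (x - a) ^+ i) (f x).

(** u is the asymptotic expansion of f at a.  Products and uniqueness are
    elementary at this level; only derivatives need convergent power series.  The
    point a itself is left out, since rational functions are
    compared away from their poles. *)
Definition asymptotic f a u := forall n, exists B d : K, [/\ 0 <= B, 0 < d &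
  forall x, 0 < `|x - a| < d -> `|f x - (fps_trunc n u).[x - a]| <= B * `|x - a| ^+ n].

Lemma horner_trunc n u t : (fps_trunc n u).[t] = \sum_(i < n) fcoef u i * t ^+ i.
Proof. by rewrite horner_poly. Qed.

(** On the disc of half the radius the terms are dominated by a geometric
    series of ratio 1/2. *)
Lemma geometric_sum s C t n u m : 0 < s -> `|t| <= s / 2 ->
  (forall i, `|fcoef u i| * s ^+ i <= C) ->
  \sum_(i < m) `|fcoef u (n + i) * t ^+ i| <= C / s ^+ n * 2.
Proof.
move=> s0 ts Cb; have C0 : 0 <= C by apply: le_trans (Cb 0%N); rewrite mulr_ge0.
apply: le_trans (_ : C / s ^+ n * \sum_(i < m) 2^-1 ^+ i <= _); last first.
  by apply: ler_wpM2l (geometric_bound _ _); rewrite divr_ge0// exprn_ge0// ltW.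
rewrite mulr_sumr; apply: ler_sum => i _; rewrite normrM normrX.
apply: le_trans (_ : `|fcoef u (n + i)| * (s / 2) ^+ i <= _).
  by rewrite ler_wpM2l// lerXn2r// nnegrE ?divr_ge0// ltW.
rewrite exprMn mulrA ler_wpM2r ?exprn_ge0 ?invr_ge0//.
by rewrite ler_pdivlMr ?exprn_gt0// -mulrA -exprD addnC Cb.
Qed.

Lemma power_series_asymptotic f a u : power_series f a u -> asymptotic f a u.
Proof.
move=> [s s0 [[C Cb] fu]] n.
have C0 : 0 <= C by apply: le_trans (Cb 0%N); rewrite mulr_ge0.
exists (C / s ^+ n * 2), (s / 2); split.
- by rewrite mulr_ge0// divr_ge0// exprn_ge0// ltW.
- by rewrite divr_gt0.
move=> x /andP[_ xa]; rewrite horner_trunc.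
have xs : `|x - a| < s.
  by apply: lt_le_trans xa _; rewrite ler_pdivrMr// ler_peMr ?ler1n// ltW.
apply: (sums_le (N := n) _ (fu x xs)) => [|m le_nm].
  by rewrite realM ?realX ?normr_real// ger0_real// mulr_ge0// divr_ge0// exprn_ge0// ltW.
rewrite -(subnKC le_nm) big_split_ord /= addrAC subrr add0r.
apply: le_trans (ler_norm_sum _ _ _) _; rewrite mulrC.
apply: le_trans (_ : `|x - a| ^+ n *
   \sum_(i < m - n) `|fcoef u (n + i) * (x - a) ^+ i| <= _); last first.
  by apply: ler_wpM2l; rewrite ?exprn_ge0//; apply: geometric_sum => //; apply: ltW.
rewrite mulr_sumr; apply: ler_sum => i _.
by rewrite exprD mulrCA normrM normrX.
Qed.

Let der_err t h i := (t + h) ^+ i - t ^+ i - i%:R * t ^+ i.-1 * h.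

(** Second order Taylor remainder of t^i, by induction from
    R_(i+1) = (t + h) R_i + i t^(i-1) h^2. *)
Lemma der_err_bound q t h i : 0 < q -> `|t| <= q -> `|t + h| <= q ->
  q ^+ 2 * `|(t + h) ^+ i - t ^+ i - i%:R * t ^+ i.-1 * h|
    <= i%:R ^+ 2 * q ^+ i * `|h| ^+ 2.
Proof.
move=> q0 tq thq; rewrite -/(der_err t h i).
elim: i => [|i IH].
  by rewrite /der_err !expr0 subrr mul0r mul0r subrr normr0 mulr0 expr0n/= !mul0r.
have -> : der_err t h i.+1 = (t + h) * der_err t h i + i%:R * t ^+ i.-1 * h ^+ 2.
  rewrite /der_err -natr1; case: i {IH} => [|i] /=; first by ring.
  by rewrite !exprS; ring.
apply: le_trans (_ : q * (q ^+ 2 * `|der_err t h i|)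
     + q ^+ 2 * (i%:R * q ^+ i.-1 * `|h| ^+ 2) <= _).
  rewrite [leRHS](_ : _ = q ^+ 2 * (q * `|der_err t h i| + i%:R * q ^+ i.-1 * `|h| ^+ 2)); last by ring.
  rewrite ler_wpM2l ?exprn_ge0 ?(ltW q0)//.
  apply: le_trans (ler_normD _ _) _; apply: lerD; rewrite !normrM.
    by rewrite ler_wpM2r.
  rewrite normr_nat !normrX -mulrA -[leRHS]mulrA ler_wpM2l// ler_wpM2r ?exprn_ge0//.
  by rewrite lerXn2r// nnegrE ltW.
apply: le_trans (_ : q * (i%:R ^+ 2 * q ^+ i * `|h| ^+ 2)
     + q * (i%:R * q ^+ i * `|h| ^+ 2) <= _).
  apply: lerD; first by rewrite ler_wpM2l// ltW.
  case: (i) => [|j] /=; first by rewrite !mul0r !mulr0.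
  by rewrite [q ^+ j.+1]exprS le_eqVlt; apply/orP; left; apply/eqP; ring.
rewrite -subr_ge0 [q ^+ i.+1]exprS -natr1.
rewrite [leRHS](_ : _ = (i%:R + 1) * q * q ^+ i * `|h| ^+ 2); last by ring.
by rewrite !mulr_ge0 ?exprn_ge0 ?addr_ge0// ltW.
Qed.

Lemma increment_bound f a u (s C t h x l : K) :
  0 < s -> (forall i, `|fcoef u i| * s ^+ i <= C) ->
  (forall x, `|x - a| < s -> sums (fun i => fcoef u i * (x - a) ^+ i) (f x)) ->
  x = a + t -> `|t| < s / 4 -> `|h| < s / 4 ->
  sums (fun i => fcoef (fder u) i * t ^+ i) l ->
  `|f (x + h) - f x - h * l| <= C * 6 / (s / 2) ^+ 2 * `|h| ^+ 2.
Proof.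
move=> s0 Cb fu -> ts hs gs; set q := s / 2.
have C0 : 0 <= C by apply: le_trans (Cb 0%N); rewrite mulr_ge0.
have q0 : 0 < q by rewrite divr_gt0.
have q4 : s / 4 + s / 4 = q by rewrite /q; field.
have s40 : 0 < s / 4 by rewrite divr_gt0.
have ths : `|t + h| < q.
  by apply: le_lt_trans (ler_normD _ _) _; rewrite -q4 ltrD.
have tq : `|t| < q by apply: lt_trans ts _; rewrite -q4 ltrDl.
have qs : q < s by rewrite /q ltr_pdivrMr// ltr_pMr ?ltr1n.
have E1 : a + t + h - a = t + h by ring.
have f1 := fu (a + t + h); rewrite E1 in f1.
have E2 : a + t - a = t by ring.
have f2 := fu (a + t); rewrite E2 in f2.
have {}f1 := f1 (lt_trans ths qs); have {}f2 := f2 (lt_trans tq qs).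
have f3 : sums (fun i => fcoef u i * (i%:R * t ^+ i.-1)) l.
  rewrite /sums -cvg_shiftS /= [X in X @ _ --> _](_ : _ = (fun n =>
    \sum_(i < n) fcoef (fder u) i * t ^+ i))//.
  apply/funext => n; rewrite big_ord_recl mul0r mulr0 add0r.
  by apply: eq_bigr => i _; rewrite lift0 /= mulr_natl mulrnAr mulrnAl.
have := sumsD (sumsD f1 (@sumsZ _ (-1) _ _ f2)) (@sumsZ _ (- h) _ _ f3).
rewrite mulN1r mulNr => S.
have Br : C * 6 / q ^+ 2 * `|h| ^+ 2 \is Num.real.
  by rewrite ger0_real// !mulr_ge0// ?invr_ge0 ?exprn_ge0// ltW.
apply: (sums_norm_le Br S) => n.
rewrite [leRHS](_ : _ = (q ^+ 2)^-1 * `|h| ^+ 2 * C * 6); last by ring.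
apply: le_trans (_ : (q ^+ 2)^-1 * `|h| ^+ 2 * C
    * \sum_(i < n) (i%:R ^+ 2 * 2^-1 ^+ i) <= _); last first.
  rewrite ler_wpM2l ?square_geometric_bound//.
  by rewrite !mulr_ge0// ?invr_ge0 ?exprn_ge0// ltW.
rewrite mulr_sumr; apply: ler_sum => i _.
rewrite (_ : _ + _ = fcoef u i * ((t + h) ^+ i - t ^+ i - i%:R * t ^+ i.-1 * h)); last by ring.
have E := der_err_bound i q0 (ltW tq) (ltW ths).
rewrite normrM -(ler_pM2l (exprn_gt0 2 q0)) mulrCA.
apply: le_trans (ler_wpM2l (normr_ge0 _) E) _.
rewrite !mulrA mulfV ?gt_eqF ?exprn_gt0// mul1r.
rewrite [leLHS](_ : _ = `|h| ^+ 2 * i%:R ^+ 2 * (`|fcoef u i| * q ^+ i)); last by ring.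
rewrite [leRHS](_ : _ = `|h| ^+ 2 * i%:R ^+ 2 * (C * 2^-1 ^+ i)); last by ring.
rewrite ler_wpM2l ?mulr_ge0 ?exprn_ge0// /q exprMn mulrA ler_wpM2r ?exprn_ge0 ?invr_ge0//.
Qed.

(** Termwise differentiation: by [increment_bound] the difference quotient
    differs from the termwise derivative by O(h). *)
Lemma power_series_derive f a u :
  power_series f a u -> power_series (derive1 f) a (fder u).
Proof.
move=> [s s0 [[C Cb] fu]].
have C0 : 0 <= C by apply: le_trans (Cb 0%N); rewrite mulr_ge0.
have s20 : 0 < s / 2 by rewrite divr_gt0.
have Cb' i : `|fcoef (fder u) i| * (s / 2) ^+ i <= C / s.
  rewrite /= normrMn exprMn mulrnAl -mulr_natl.
  rewrite [leLHS](_ : _ = (i.+1%:R * 2^-1 ^+ i) * (`|fcoef u i.+1| * s ^+ i)); last by ring.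
  apply: le_trans (_ : 1 * (`|fcoef u i.+1| * s ^+ i) <= _).
    rewrite ler_wpM2r ?mulr_ge0 ?exprn_ge0 ?(ltW s0)// exprVn.
    by rewrite ler_pdivrMr ?exprn_gt0// mul1r -natrX ler_nat ltn_expl.
  by rewrite mul1r ler_pdivlMr// -mulrA -exprSr Cb.
have s4 : s / 4 = s / 2 / 2 by field.
exists (s / 4); first by rewrite divr_gt0.
split.
  exists (C / s) => i; apply: le_trans (Cb' i); rewrite ler_wpM2l// lerXn2r ?nnegrE ?divr_ge0 ?(ltW s0)//.
  by rewrite s4 ler_pdivrMr// ler_peMr ?ler1n// ltW.
move=> x xs; set t := x - a in xs *.
have Ex : x = a + t by rewrite /t addrC subrK.
have [l gs] : exists l, sums (fun i => fcoef (fder u) i * t ^+ i) l.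
  apply: Kcomplete; exists (C / s / (s / 2) ^+ 0 * 2) => n.
  by apply: (geometric_sum 0 n s20 _ Cb'); rewrite -s4 ltW.
suff -> : derive1 f x = l by [].
have [A A0 HA] : exists2 A : K, 0 <= A & forall h, `|h| < s / 4 ->
    `|f (x + h) - f x - h * l| <= A * `|h| ^+ 2.
  exists (C * 6 / (s / 2) ^+ 2).
    by rewrite !mulr_ge0// invr_ge0 exprn_ge0// ltW.
  by move=> h hs; apply: (increment_bound s0 Cb fu Ex xs hs gs).
rewrite /derive1; apply: cvg_lim; first exact: norm_hausdorff.
apply/cvgrPdist_lt => e e0.
have d0 : 0 < e / (A + 1) by rewrite divr_gt0// ltr_wpDl.
have s40 : 0 < s / 4 by rewrite divr_gt0.
near=> h.
have h0 : h != 0 by near: h; exact: nbhs_dnbhs_neq.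
have hs : `|h| < s / 4 by near: h; apply: dnbhs0_lt.
have he : `|h| < e / (A + 1) by near: h; apply: dnbhs0_lt.
have nh : 0 < `|h| by rewrite normr_gt0.
rewrite [h + x]addrC -(ltr_pM2l nh) -normrM mulrBr -[_ *: _]/(h^-1 * _) mulrA mulfV// mul1r.
rewrite distrC; apply: le_lt_trans (HA h hs) _.
rewrite expr2 mulrCA ltr_pM2l//.
apply: le_lt_trans (_ : (A + 1) * `|h| < _).
  by rewrite ler_wpM2r// lerDl.
by rewrite mulrC -ltr_pdivlMr// ltr_wpDl.
Unshelve. all: by end_near.
Qed.

End PowerSeries.

(** * Asymptotic expansions *)

Section Asymptotic.
Variable K : numFieldType.
Implicit Types (f g : K -> K) (u v : fps K) (a x t : K).

Lemma common_radius (d1 d2 : K) : 0 < d1 -> 0 < d2 ->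
  exists d, [/\ 0 < d, d <= d1 & d <= d2].
Proof.
move=> d10 d20; exists (d1 * d2 / (d1 + d2)).
have s0 : 0 < d1 + d2 by rewrite addr_gt0.
split; first by rewrite divr_gt0// mulr_gt0.
  by rewrite ler_pdivrMr// ler_pM2l// lerDr ltW.
by rewrite ler_pdivrMr// mulrC ler_pM2l// lerDl ltW.
Qed.

Lemma horner_norm_le (p : {poly K}) t : `|t| <= 1 ->
  `|p.[t]| <= \sum_(i < size p) `|p`_i|.
Proof.
move=> t1; rewrite horner_coef; apply: le_trans (ler_norm_sum _ _ _) _.
apply: ler_sum => i _; rewrite normrM normrX ler_piMr//.
exact: exprn_ile1.
Qed.

Lemma asymptotic_mul f g a u v :
  asymptotic f a u -> asymptotic g a v -> asymptotic (fun x => f x * g x) a (u * v).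
Proof.
move=> Hf Hg n; have [B1 [d1 [B10 d10 H1]]] := Hf n.
have [B2 [d2 [B20 d20 H2]]] := Hg n.
have [d3 [d30 d31 d32]] := common_radius d10 d20.
have [d [d0 dd3 d1']] := common_radius d30 ltr01.
pose P := fps_trunc n u; pose Q := fps_trunc n v; pose D := drop_poly n (P * Q).
pose SP := \sum_(i < size P) `|P`_i|; pose SQ := \sum_(i < size Q) `|Q`_i|.
pose SD := \sum_(i < size D) `|D`_i|.
exists (B1 * (B2 + SQ) + SP * B2 + SD), d; split=> //.
  by rewrite !addr_ge0// ?mulr_ge0 ?addr_ge0// ?sumr_ge0.
move=> x /andP[t0 td]; set t := x - a in t0 td *.
have t1 : `|t| <= 1 by apply: ltW; apply: lt_le_trans td d1'.
have tn1 : `|t| ^+ n <= 1 by apply: exprn_ile1.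
have e1 : `|f x - P.[t]| <= B1 * `|t| ^+ n.
  by apply: H1; rewrite t0 /=; apply: lt_le_trans td _; apply: le_trans dd3 d31.
have e2 : `|g x - Q.[t]| <= B2 * `|t| ^+ n.
  by apply: H2; rewrite t0 /=; apply: lt_le_trans td _; apply: le_trans dd3 d32.
have ER : fps_trunc n (u * v) = P * Q - D * 'X^n.
  rewrite -[X in X - _](poly_take_drop n) -/D addrK; apply/polyP => i.
  by rewrite coef_take_poly coef_poly; case: ltnP => // /fcoef_trunc ->.
rewrite ER !hornerE.
have -> : f x * g x - (P.[t] * Q.[t] - D.[t] * t ^+ n)
   = (f x - P.[t]) * ((g x - Q.[t]) + Q.[t]) + P.[t] * (g x - Q.[t]) + D.[t] * t ^+ n.
  by ring.
apply: le_trans (ler_normD _ _) _; rewrite [leRHS]mulrDl; apply: lerD; last first.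
  by rewrite normrM normrX ler_wpM2r ?exprn_ge0// horner_norm_le.
apply: le_trans (ler_normD _ _) _; rewrite [leRHS]mulrDl; apply: lerD; last first.
  by rewrite normrM -mulrA ler_pM// horner_norm_le.
rewrite normrM mulrAC ler_pM//; apply: le_trans (ler_normD _ _) _.
apply: lerD; last exact: horner_norm_le.
by apply: le_trans e2 _; rewrite ler_piMr.
Qed.

Lemma asymptotic_add f g a u v :
  asymptotic f a u -> asymptotic g a v -> asymptotic (fun x => f x + g x) a (u + v).
Proof.
move=> Hf Hg n; have [B1 [d1 [B10 d10 H1]]] := Hf n.
have [B2 [d2 [B20 d20 H2]]] := Hg n.
have [d [d0 dd1 dd2]] := common_radius d10 d20.
exists (B1 + B2), d; split=> //; first exact: addr_ge0.
move=> x /andP[t0 td].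
have -> : fps_trunc n (u + v) = fps_trunc n u + fps_trunc n v.
  by apply/polyP => i; rewrite coefD !coef_poly; case: ifP => _; rewrite ?addr0.
rewrite hornerD opprD addrACA mulrDl; apply: le_trans (ler_normD _ _) _.
apply: lerD; [apply: H1|apply: H2]; rewrite t0 /=; exact: lt_le_trans td _.
Qed.

Lemma asymptotic_horner (p : {poly K}) a : asymptotic (horner p) a (taylor a p).
Proof.
move=> n; pose q := p \Po ('X + a%:P); pose D := drop_poly n q.
exists (\sum_(i < size D) `|D`_i|), 1; split=> //; first by rewrite sumr_ge0.
move=> x /andP[_ /ltW t1].
have -> : fps_trunc n (taylor a p) = take_poly n q.
  by apply/polyP => i; rewrite [RHS]coef_take_poly coef_poly.
have -> : p.[x] = q.[x - a] by rewrite horner_comp !hornerE subrK.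
rewrite -[X in X.[_] - _](poly_take_drop n q) !hornerE addrAC subrr add0r.
by rewrite normrM normrX ler_wpM2r ?exprn_ge0// horner_norm_le.
Qed.

Lemma asymptotic_cst (c : K) a : asymptotic (fun=> c) a (fpsC c).
Proof.
rewrite -(taylorC a); have := asymptotic_horner c%:P a.
by rewrite (_ : horner _ = (fun=> c))//; apply/funext => x; rewrite hornerC.
Qed.

Lemma asymptotic_sum n (F : nat -> K -> K) (U : nat -> fps K) a :
  (forall i, (i < n)%N -> asymptotic (F i) a (U i)) ->
  asymptotic (fun x => \sum_(i < n) F i x) a (\sum_(i < n) U i).
Proof.
elim: n => [|n IH] H.
  rewrite big_ord0 (_ : (fun=> _) = (fun=> 0)); last first.
    by apply/funext => x; rewrite big_ord0.
  have := asymptotic_cst 0 a; congr asymptotic.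
  by apply: fpsP => i /=; rewrite if_same.
rewrite big_ord_recr (_ : (fun=> _) = (fun x => \sum_(i < n) F i x + F n x)).
  by apply: asymptotic_add; [apply: IH => i /ltnW; apply: H|apply: H].
by apply/funext => x; rewrite big_ord_recr.
Qed.

Lemma asymptotic_scale (c : K) f a u :
  asymptotic f a u -> asymptotic (fun x => c * f x) a (fpsC c * u).
Proof. exact: asymptotic_mul (asymptotic_cst c a). Qed.

(** Near a the first nonzero term u_n t^n dominates the remainder. *)
Lemma asymptotic_neq0 f a u : asymptotic f a u -> u <> 0 ->
  exists2 d : K, 0 < d & forall x, 0 < `|x - a| < d -> f x != 0.
Proof.
move=> Hf une; have exn : exists n, fcoef u n != 0.
  apply: contrapT => /forallNP z; apply: une; apply: fpsP => e.
  by apply/eqP; have /negP := z e; rewrite negbK.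
case: (ex_minnP exn) => n un min_n.
have [B [d [B0 d0 H]]] := Hf n.+1.
have n0 : 0 < `|fcoef u n| by rewrite normr_gt0.
have B10 : 0 < B + 1 by rewrite ltr_wpDl.
have [d' [d'0 dd1 dd2]] := common_radius d0 (divr_gt0 n0 B10).
exists d' => // x /andP[t0 td]; apply/eqP => fx.
have := H x; rewrite t0 (lt_le_trans td dd1) => /(_ isT).
rewrite fx sub0r normrN horner_trunc big_ord_recr /= big1 ?add0r; last first.
  move=> i _; suff -> : fcoef u i = 0 by rewrite mul0r.
  by apply/eqP/negPn/negP => /min_n; rewrite leqNgt ltn_ord.
rewrite normrM normrX exprS mulrA ler_pM2r ?exprn_gt0// => le.
have := lt_le_trans td dd2; rewrite ltr_pdivlMr// => /lt_le_trans/(_ le).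
by rewrite mulrDr mulr1 [B * _]mulrC gtrDl normr_lt0.
Qed.

Lemma asymptotic_unique f g a u v (d : K) :
  asymptotic f a u -> asymptotic g a v -> 0 < d ->
  (forall x, 0 < `|x - a| < d -> f x = g x) -> u = v.
Proof.
move=> Hf Hg d0 E; apply/eqP; rewrite -subr_eq0; apply/negPn/negP => /eqP une.
have Hfg : asymptotic (fun x => f x + -1 * g x) a (u - v).
  have -> : u - v = u + fpsC (-1) * v.
    by apply: fpsP => i; rewrite !fcoefD fcoefCM mulN1r.
  exact: asymptotic_add Hf (asymptotic_scale (-1) Hg).
have [d' d'0 Hd] := asymptotic_neq0 Hfg une.
have [d2 [d20 le1 le2]] := common_radius d0 d'0.
have nx : `|a + d2 / 2 - a| = d2 / 2.
  by rewrite addrAC subrr add0r gtr0_norm// divr_gt0.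
have lt2 : d2 / 2 < d2 by rewrite ltr_pdivrMr// ltr_pMr// ltr1n.
have x0 : 0 < d2 / 2 by rewrite divr_gt0.
have := Hd (a + d2 / 2); rewrite nx x0 (lt_le_trans lt2 le2) => /(_ isT).
by rewrite E ?mulN1r ?subrr ?eqxx// nx x0 (lt_le_trans lt2 le1).
Qed.

End Asymptotic.

(** * Double power series and the identity theorem *)

Lemma sum_ord_split (V : nmodType) n m (G : nat -> V) : (n <= m)%N ->
  \sum_(i < m) G i = \sum_(i < n) G i + \sum_(i < m - n) G (n + i)%N.
Proof.
by move=> le_nm; have [k ->] : exists k, m = (n + k)%N;
  [exists (m - n)%N; rewrite subnKC | rewrite addKn big_split_ord].
Qed.

Section DoubleSeries.
Variable K : numFieldType.
Hypothesis Kcomplete : abs_complete K.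

(** Fubini for an absolutely convergent double series summed over squares:
    the sum over i < n of the rows differs from the sum over a large square by
    at most the tail of the sums of absolute values. *)
Lemma sums_iterated (u : nat -> nat -> K) (l M : K) (R : nat -> K) :
  (forall n, \sum_(i < n) \sum_(j < n) `|u i j| <= M) ->
  \sum_(i < n) \sum_(j < n) u i j @[n --> \oo] --> l ->
  (forall i, sums (u i) (R i)) -> sums R l.
Proof.
move=> uM ul uR; pose T n := \sum_(i < n) \sum_(j < n) `|u i j|.
have T_mono n m : (n <= m)%N -> T n <= \sum_(i < n) \sum_(j < m) `|u i j|.
  move=> le_nm; apply: ler_sum => i _; rewrite (sum_ord_split (fun j => `|u i j|) le_nm).
  by rewrite lerDl sumr_ge0.
have T_split n m : (n <= m)%N -> T m = \sum_(i < n) \sum_(j < m) `|u i j|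
    + \sum_(i < m - n) \sum_(j < m) `|u (n + i)%N j|.
  by move=> le_nm; rewrite /T (sum_ord_split (fun i => \sum_(j < m) `|u i j|) le_nm).
have T_le n m : (n <= m)%N -> T n <= T m.
  move=> le_nm; rewrite (T_split n m le_nm); apply: le_trans (T_mono _ _ le_nm) _.
  by rewrite lerDl; apply: sumr_ge0 => i _; apply: sumr_ge0.
have [L TL] : exists L, sums (fun n => T n.+1 - T n) L.
  apply: Kcomplete; exists M => n.
  have -> : \sum_(i < n) `|T i.+1 - T i| = T n.
    elim: n => [|n IH]; first by rewrite /T !big_ord0.
    by rewrite big_ord_recr /= IH ger0_norm ?subr_ge0 ?T_le// addrC subrK.
  exact: uM.
have tele n : \sum_(i < n) (T i.+1 - T i) = T n.
  elim: n => [|n IH]; first by rewrite /T !big_ord0.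
  by rewrite big_ord_recr /= IH addrC subrK.
apply/sumsP => e e0; have e3 : 0 < e / 3 by rewrite divr_gt0.
have [N HN] := (sumsP _ _).1 TL _ e3; exists N => n le_Nn.
apply: (le_lt_trans (y := e / 3 + e / 3)); last first.
  by rewrite -subr_gt0 (_ : _ - _ = e / 3)//; field.
rewrite -[X in `|X|]subr0.
apply: (sums_le (N := n) (s := fun m => \sum_(i < m) \sum_(j < m) u i j
    - \sum_(i < n) \sum_(j < m) u i j)).
- by rewrite realD ?gtr0_real.
- apply: cvgB => //.
  have H k : \sum_(i < k) \sum_(j < m) u i j @[m --> \oo] --> \sum_(i < k) R i.
    elim: k => [|k IH].
      rewrite big_ord0 (_ : (fun=> _) = (fun=> 0)); first exact: cvg_cst.
      by apply/funext => m; rewrite big_ord0.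
    rewrite big_ord_recr (_ : (fun=> _) =
      (fun m => \sum_(i < k) \sum_(j < m) u i j + \sum_(j < m) u k j)).
      by apply: cvgD => //; apply: uR.
    by apply/funext => m; rewrite big_ord_recr.
  exact: H.
- move=> m le_nm; rewrite subr0.
  rewrite (sum_ord_split (fun i => \sum_(j < m) u i j) le_nm).
  rewrite addrAC subrr add0r.
  apply: le_trans (_ : T m - T n <= _).
    rewrite (T_split n m le_nm) -[leLHS]add0r; apply: le_trans (_ : 0 + \sum_(i < m - n) \sum_(j < m) `|u (n + i)%N j| <= _).
      rewrite !add0r; apply: le_trans (ler_norm_sum _ _ _) _.
      by apply: ler_sum => i _; apply: ler_norm_sum.
    by rewrite addrAC lerD2r subr_ge0 T_mono.
  have -> : T m - T n = (L - T n) - (L - T m) by ring.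
  have Tmn : 0 <= T m - T n by rewrite subr_ge0 T_le.
  have -> : (L - T n) - (L - T m) = `|(L - T n) - (L - T m)|.
    by rewrite ger0_norm// (_ : _ - _ = T m - T n)//; ring.
  apply: le_trans (ler_normB _ _) _.
  have hn := HN n le_Nn; have hm := HN m (leq_trans le_Nn le_nm).
  by rewrite !tele in hn hm; rewrite lerD// ltW.
Qed.

Lemma power_series_of_sums f (a r : K) (c : nat -> K) : 0 < r ->
  (forall x, `|x - a| < r -> sums (fun i => c i * (x - a) ^+ i) (f x)) ->
  power_series f a (Fps c).
Proof.
move=> r0 H; have r20 : 0 < r / 2 by rewrite divr_gt0.
have r2r : r / 2 < r by rewrite ltr_pdivrMr// ltr_pMr// ltr1n.
exists (r / 2) => //; split; last by move=> x xr; apply/H/(lt_trans xr).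
have := H (a + r / 2); rewrite addrAC subrr add0r gtr0_norm// => /(_ r2r).
move/sums_bounded => [C Cb]; exists C => i.
by have := Cb i; rewrite normrM normrX [`|r / 2|]gtr0_norm.
Qed.

Section Double.
Variables (psi : K -> K -> K) (a b r : K) (c : nat -> nat -> K).
Hypothesis r_gt0 : 0 < r.
Hypothesis psi_series : forall x z, `|x - a| < r -> `|z - b| < r ->
  (exists M : K, forall n : nat,
     \sum_(i < n) \sum_(j < n) `|c i j * (x - a) ^+ i * (z - b) ^+ j| <= M)
  /\ (\sum_(i < n) \sum_(j < n) c i j * (x - a) ^+ i * (z - b) ^+ j)
       @[n --> \oo] --> psi x z.

(** The i-th coefficient of psi in the first variable, as a function of the
    second one. *)
Definition row_sum (i : nat) (z : K) : K :=
  limn (fun n => \sum_(j < n) c i j * (z - b) ^+ j).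

Lemma row_sumP i z : `|z - b| < r ->
  sums (fun j => c i j * (z - b) ^+ j) (row_sum i z).
Proof.
move=> zr; have r20 : 0 < r / 2 by rewrite divr_gt0.
have x0r : `|a + r / 2 - a| < r.
  by rewrite addrAC subrr add0r gtr0_norm// ltr_pdivrMr// ltr_pMr// ltr1n.
have [[M HM] _] := psi_series x0r zr.
have [l cl] : exists l, sums (fun j => c i j * (z - b) ^+ j) l.
  apply: Kcomplete; exists (M / (r / 2) ^+ i) => n.
  rewrite ler_pdivlMr ?exprn_gt0//.
  pose m := maxn n i.+1; have lt_im : (i < m)%N by rewrite leq_maxr.
  apply: le_trans (HM m); rewrite (bigD1 (Ordinal lt_im)) //=.
  rewrite -[leLHS]addr0; apply: lerD; last first.
    by apply: sumr_ge0 => j _; apply: sumr_ge0.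
  rewrite (sum_ord_split (fun j => `|c i j * (a + r / 2 - a) ^+ i * (z - b) ^+ j|)
    (leq_maxl n i.+1)) mulr_suml.
  rewrite -[leLHS]addr0; apply: lerD; last exact: sumr_ge0.
  apply: ler_sum => j _; rewrite addrAC subrr add0r !normrM !normrX.
  by rewrite [`|r / 2|]gtr0_norm// mulrAC.
rewrite /row_sum; suff -> : limn (fun n => \sum_(j < n) c i j * (z - b) ^+ j) = l.
  by [].
by apply: cvg_lim => //; exact: norm_hausdorff.
Qed.

Lemma psi_row_series z : `|z - b| < r ->
  power_series (psi^~ z) a (Fps (row_sum^~ z)).
Proof.
move=> zr; apply: (power_series_of_sums r_gt0) => x xr.
have [[M HM] Hl] := psi_series xr zr.
apply: (sums_iterated (u := fun i j => c i j * (x - a) ^+ i * (z - b) ^+ j) HM Hl).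
move=> i.
have := @sumsZ _ ((x - a) ^+ i) _ _ (@row_sumP i z zr).
rewrite [X in sums _ X]mulrC; congr sums; apply/funext => j.
by rewrite mulrA [_ ^+ i * _]mulrC.
Qed.

Lemma row_sum_series i : power_series (row_sum i) b (Fps (c i)).
Proof. by apply: (power_series_of_sums r_gt0) => z zr; apply: row_sumP. Qed.

End Double.

End DoubleSeries.

Section Identity.
Variable K : numFieldType.

Lemma analytic_on_power_series (U : set K) f a :
  analytic_on U f -> U a -> exists u, power_series f a u.
Proof.
move=> fU /fU[r r0 [c H]]; exists (Fps c).
exact: power_series_of_sums r0 H.
Qed.

Lemma power_series_const f (a c : K) : power_series f a (fpsC c) ->
  exists2 d : K, 0 < d & forall x, `|x - a| < d -> f x = c.
Proof.
move=> [s s0 [_ H]]; exists s => // x /H fx; apply: sums_unique fx _.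
apply/sumsP => e e0; exists 1%N => -[//|n] _.
rewrite big_ord_recl /= expr0 mulr1 big1 ?addr0 ?subrr ?normr0// => i _.
by rewrite mul0r.
Qed.

(** Identity theorem.  The set of points near which f equals f(a) is open;
    its complement in U is open too, because f - f(a) has a nonzero expansion
    at such a point, hence no zero nearby except possibly the point itself. *)
Lemma nonconstant_coef (U : set K) f a u :
  domain U -> analytic_on U f -> nonconstant_on U f -> U a ->
  power_series f a u -> exists2 k, (0 < k)%N & fcoef u k != 0.
Proof.
move=> [Uopen Uconn _] fU [x1 [x2 [Ux1 Ux2 ne]]] Ua fu.
apply: contrapT => /forall2NP H0.
have uC : u = fpsC (fcoef u 0).
  apply: fpsP => -[//|k] /=; apply/eqP/negPn/negP => uk.
  by have [|] := H0 k.+1.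
pose O := [set y : K | \forall x \near y, f x = f a].
pose S := U `&` O.
have Sa : S a.
  split=> //; rewrite uC in fu; have [d d0 Hd] := power_series_const fu.
  have fa : f a = fcoef u 0 by apply: Hd; rewrite subrr normr0.
  apply/nbhs_ballP; exists d => // x; rewrite -ball_normE /= distrC => xd.
  by rewrite fa Hd.
have O_open : open O by exact: (@open_interior _ [set x | f x = f a]).
(* points of U outside S have a whole neighbourhood outside S *)
have away y : U y -> ~ O y -> \forall x \near y, ~ S x.
  move=> Uy Oy; have [w fw] := analytic_on_power_series fU Uy.
  have Hw : asymptotic (fun x => f x + -1 * f a) y (w + fpsC (-1) * fpsC (f a)).
    apply: asymptotic_add (power_series_asymptotic fw) _.
    exact: asymptotic_scale (asymptotic_cst _ _).
  have wne : w + fpsC (-1) * fpsC (f a) <> 0.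
    move=> w0; apply: Oy; have Ew : w = fpsC (f a).
      apply: fpsP => k; have := congr1 (fun v => fcoef v k) w0.
      by rewrite fcoefD fcoefCM fcoef0 mulN1r => /eqP; rewrite subr_eq0 => /eqP.
    rewrite Ew in fw; have [d d0 Hd] := power_series_const fw.
    apply/nbhs_ballP; exists d => // x; rewrite -ball_normE /= distrC => xd.
    exact: Hd.
  have [d d0 Hd] := asymptotic_neq0 Hw wne.
  apply/nbhs_ballP; exists d => // x; rewrite -ball_normE /= distrC => xd [_ Ox].
  have [Exy|ne_xy] := eqVneq x y; first by apply: Oy; rewrite -Exy.
  have := Hd x; rewrite normr_gt0 subr_eq0 ne_xy xd => /(_ isT)/eqP; apply.
  by rewrite (nbhs_singleton Ox) mulN1r subrr.
have SU : S = U.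
  apply: Uconn.
  - by exists a.
  - by exists O.
  - exists (~` [set y | \forall x \near y, ~ S x]).
      by rewrite closedC; exact: (@open_interior _ [set x | ~ S x]).
    apply/seteqP; split=> y [Uy Oy]; split=> //.
      by move=> /nbhs_singleton; apply.
    by apply: contrapT => nO; apply: Oy; apply: away.
have fx y : U y -> f y = f a.
  by rewrite -SU => -[_ Oy]; exact: (nbhs_singleton Oy).
by move: ne; rewrite (fx _ Ux1) (fx _ Ux2) eqxx.
Qed.

End Identity.

(** * Formal expansion of a bispectral operator *)

Section FormalExpansion.
Variable K : numFieldType.
Hypothesis Kcomplete : abs_complete K.

Lemma power_series_derive1n k f (a : K) u :
  power_series f a u -> power_series (derive1n k f) a (iter k (@fder K) u).
Proof.
move=> fu; elim: k => [//|k IH]; rewrite derive1nS iterS.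
exact: power_series_derive.
Qed.

Lemma opact_poly N (v : nat -> fps K) u :
  opact (@fder K) (\poly_(i < N) v i) u = \sum_(k < N) v k * iter k (@fder K) u.
Proof.
rewrite (opact_wide _ _ (size_poly _ _)).
by apply: eq_bigr => k _; rewrite coef_poly ltn_ord.
Qed.

Lemma diffop_series N (V : nat -> K -> K) (v : nat -> fps K) (phi : K -> K)
    (u : fps K) (a lam d : K) :
  (forall k, (k <= N)%N -> power_series (V k) a (v k)) ->
  power_series phi a u -> 0 < d ->
  (forall x, `|x - a| < d -> diffop N V phi x = lam * phi x) ->
  \sum_(k < N.+1) v k * iter k (@fder K) u = fpsC lam * u.
Proof.
move=> Vv phiu d0 E.
have L := @asymptotic_sum _ N.+1 (fun k x => V k x * derive1n k phi x)
  (fun k => v k * iter k (@fder K) u) a _.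
apply: (asymptotic_unique (L _) _ d0) => [k lt_k||x /andP[_ xd]].
- apply: asymptotic_mul; apply: power_series_asymptotic; first exact: Vv.
  exact: power_series_derive1n.
- exact: asymptotic_scale (power_series_asymptotic phiu).
- exact: E.
Qed.

(** An identity between power series in x whose coefficients are functions of
    z: each coefficient is a finite combination of analytic functions of z, and
    can be expanded in turn. *)
Lemma coefficient_series N (v : nat -> fps K) (D : nat -> K -> K)
    (c : nat -> fps K) (h : K -> K) (hh : fps K) (b d : K) (i : nat) :
  (forall i, power_series (D i) b (c i)) -> power_series h b hh -> 0 < d ->
  (forall z, `|z - b| < d ->
     \sum_(k < N.+1) v k * iter k (@fder K) (Fps (D^~ z)) = fpsC (h z) * Fps (D^~ z)) ->
  \sum_(k < N.+1) \sum_(l < i.+1)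
     fpsC (fcoef (v k) l) * (c (i - l + k)%N *+ (i - l + k) ^_ k) = hh * c i.
Proof.
move=> Dc hs d0 E.
have S1 k : asymptotic
    (fun z => \sum_(l < i.+1) (fcoef (v k) l * ((i - l + k) ^_ k)%:R) * D (i - l + k)%N z) b
    (\sum_(l < i.+1) fpsC (fcoef (v k) l * ((i - l + k) ^_ k)%:R) * c (i - l + k)%N).
  apply: (asymptotic_sum
    (F := fun l z => (fcoef (v k) l * ((i - l + k) ^_ k)%:R) * D (i - l + k)%N z)
    (U := fun l => fpsC (fcoef (v k) l * ((i - l + k) ^_ k)%:R) * c (i - l + k)%N)).
  by move=> l _; apply: asymptotic_scale; apply: power_series_asymptotic.
have S2 := @asymptotic_sum _ N.+1 _ _ b (fun k _ => S1 k).
have S3 := asymptotic_mul (power_series_asymptotic hs)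
  (power_series_asymptotic (Dc i)).
rewrite -(asymptotic_unique S2 S3 d0) => [|z /andP[_ zd]].
  apply: eq_bigr => k _; apply: eq_bigr => l _.
  by apply: fpsP => n; rewrite !fcoefCM fcoefMn -mulrA mulr_natl.
have := congr1 (fun u => fcoef u i) (E z zd); rewrite fcoefCM fcoef_sum => <-.
apply: eq_bigr => k _; rewrite fcoefM; apply: eq_bigr => l _.
by rewrite iter_fder /= -mulrA mulr_natl.
Qed.

(** Psi j is the coefficient of (z - b)^j, a power series in x - a.  The
    equation in x holds for each z near b and is then expanded in z; the one in
    z is treated with the roles of the two variables exchanged. *)
Lemma bispectral_formal (N : nat) (V : nat -> K -> K) : bispectral N V ->
  exists (a : K) (v : nat -> fps K) (Psi : fps (fps K)) (m : nat)
    (A : nat -> nat -> K) (f : nat -> K) (theta : fps K),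
  [/\ forall k, (k <= N)%N -> asymptotic (V k) a (v k),
      forall j, opact (@fder K) (\poly_(i < N.+1) v i) (fcoef Psi j)
        = \sum_(i < j.+1) fpsC (f i) * fcoef Psi (j - i),
      forall j, \sum_(l < m.+1) \sum_(i < j.+1)
         fpsC (A l i) * (fcoef Psi (j - i + l) *+ (j - i + l) ^_ l)
        = theta * fcoef Psi j &
   [/\ fcoef Psi 0 != 0, exists2 k, (0 < k)%N & f k != 0
     & exists2 k, (0 < k)%N & fcoef theta k != 0]].
Proof.
move=> [U [W [m [A [f [theta [psi [[domU domW VU AW] [[fW fnc tU tnc] [psiA
  [a [b [Ua Wb psi0]]] Lpsi Apsi]]]]]]]]]].
have [Uopen _ _] := domU; have [Wopen _ _] := domW.
have /choice[v vP] : forall k, exists u, (k <= N)%N -> power_series (V k) a u.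
  move=> k; have [le|_] := leqP k N; last by exists 0.
  by have [u Hu] := analytic_on_power_series (VU k le) Ua; exists u.
have /choice[w wP] : forall k, exists u, (k <= m)%N -> power_series (A k) b u.
  move=> k; have [le|_] := leqP k m; last by exists 0.
  by have [u Hu] := analytic_on_power_series (AW k le) Wb; exists u.
have [fh fhP] := analytic_on_power_series fW Wb.
have [th thP] := analytic_on_power_series tU Ua.
have [r r0 [c cP]] := psiA a b Ua Wb.
have cP' z x : `|z - b| < r -> `|x - a| < r ->
    (exists M : K, forall n : nat, \sum_(j < n) \sum_(i < n)
        `|c i j * (z - b) ^+ j * (x - a) ^+ i| <= M) /\
    \sum_(j < n) \sum_(i < n) c i j * (z - b) ^+ j * (x - a) ^+ i @[n --> \oo]
      --> psi x z.
  move=> zr xr; have [[M HM] Hl] := cP x z xr zr; split.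
    exists M => n; rewrite exchange_big /=; apply: le_trans (HM n).
    by apply: ler_sum => i _; apply: ler_sum => j _; rewrite mulrAC.
  rewrite (_ : (fun n => _) =
    (fun n => \sum_(i < n) \sum_(j < n) c i j * (x - a) ^+ i * (z - b) ^+ j))//.
  apply/funext => n; rewrite exchange_big /=.
  by apply: eq_bigr => i _; apply: eq_bigr => j _; rewrite mulrAC.
have [d1 d10 Ud] : exists2 d, 0 < d & forall x, `|x - a| < d -> U x.
  have /nbhs_ballP[d d0 H] := open_nbhs_nbhs (conj Uopen Ua).
  by exists d => // x xd; apply: H; rewrite -ball_normE /= distrC.
have [d2 d20 Wd] : exists2 d, 0 < d & forall z, `|z - b| < d -> W z.
  have /nbhs_ballP[d d0 H] := open_nbhs_nbhs (conj Wopen Wb).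
  by exists d => // x xd; apply: H; rewrite -ball_normE /= distrC.
have [da [da0 da1 dar]] := common_radius d10 r0.
have [db [db0 db2 dbr]] := common_radius d20 r0.
have aa : `|a - a| < da by rewrite subrr normr0.
have bb : `|b - b| < db by rewrite subrr normr0.
pose c' j i := c i j.
have row := row_sum_series Kcomplete r0 cP.
have col := row_sum_series Kcomplete (c := c') r0 cP'.
exists a, v, (Fps (fun j => Fps (c' j))), m, (fun l => fcoef (w l)), (fcoef fh), th.
split.
- by move=> k /vP /power_series_asymptotic.
- move=> j; apply: fpsP => i; rewrite opact_poly.
  have E : forall z, `|z - b| < db -> \sum_(k < N.+1) v k *
      iter k (@fder K) (Fps ((row_sum b c)^~ z)) = fpsC (f z) * Fps ((row_sum b c)^~ z).
    move=> z zb; have zr := lt_le_trans zb dbr.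
    apply: (diffop_series vP (psi_row_series Kcomplete r0 cP zr) da0) => x xa.
    by apply: Lpsi; [apply/Ud/(lt_le_trans xa da1)|apply/Wd/(lt_le_trans zb db2)].
  have := congr1 (fun u => fcoef u j) (coefficient_series i row fhP db0 E).
  rewrite fcoefM !fcoef_sum => Ec.
  transitivity (\sum_(l < j.+1) fcoef fh l * fcoef (Fps (c i)) (j - l)); last first.
    by apply: eq_bigr => l _; rewrite fcoefCM.
  rewrite -Ec; apply: eq_bigr => k _; rewrite fcoefM fcoef_sum.
  by apply: eq_bigr => l _; rewrite iter_fder fcoefCM fcoefMn.
- move=> j; apply: (coefficient_series j col thP da0) => x xa.
  have xr := lt_le_trans xa dar.
  apply: (diffop_series wP (psi_row_series Kcomplete (c := c') r0 cP' xr) db0).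
  move=> z zb.
  by apply: Apsi; [apply/Ud/(lt_le_trans xa da1)|apply/Wd/(lt_le_trans zb db2)].
- split.
  + have [_ cl] := cP a b (lt_le_trans aa dar) (lt_le_trans bb dbr).
    have Epsi : psi a b = c 0%N 0%N.
      apply: cvg_unique cl _; first exact: norm_hausdorff.
      rewrite !subrr; apply/cvgrPdist_lt => e e0; exists 1%N => // -[//|n] _ /=.
      rewrite big_ord_recl big_ord_recl !expr0 !mulr1 !big1 ?addr0 ?subrr ?normr0//.
        by move=> i _; rewrite big1// => j _; rewrite expr0n mulr0 mul0r.
      by move=> i _; rewrite expr0n mulr0.
    apply: contraNneq psi0 => /(congr1 (fun u => fcoef u 0)) /= c00.
    by rewrite Epsi -[c 0%N 0%N]/(c' 0%N 0%N) c00.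
  + exact: nonconstant_coef domW fW fnc Wb fhP.
  + exact: nonconstant_coef domU tU tnc Ua thP.
Qed.

End FormalExpansion.

(** * Absolutely convergent series of complex numbers *)

Section Completeness.
Variable R : realType.
Local Notation C := (complexes R).
Local Notation re := (@complex.Re R).
Local Notation im := (@complex.Im R).

Lemma normc_le_ReIm (z : complex R) : `|z| <= ((`|re z| + `|im z|)%:C)%C.
Proof.
rewrite normc_def lecE /= eqxx /=.
rewrite -(@ger0_norm _ (`|re z| + _)) ?addr_ge0// -sqrtr_sqr.
apply: ler_wsqrtr; rewrite sqrrD !real_normK ?num_real//.
by rewrite -addrA lerD2l lerDr mulrn_wge0// mulr_ge0.
Qed.

Lemma bounded_real_series (u : nat -> R) (m : R) :
  (forall n, \sum_(i < n) `|u i| <= m) -> cvgn (series u).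
Proof.
move=> um; apply: normed_cvg; apply: nondecreasing_is_cvgn.
  apply/nondecreasing_seqP => n /=.
  by rewrite /series /= big_nat_recr//= lerDl.
exists m => _ [n _ <-] /=; rewrite /series /= big_mkord; exact: um.
Qed.

Lemma morph_sum_ord (p : C -> R) (w : nat -> C) n :
  {morph p : x y / x + y} -> p 0 = 0 ->
  p (\sum_(i < n) w i) = \sum_(i < n) p (w i).
Proof.
by move=> pD p0; elim: n => [|n IH]; rewrite ?big_ord0// !big_ord_recr /= pD IH.
Qed.

Lemma ReD : {morph (re : C -> R) : x y / x + y}. Proof. by case=> ? ? []. Qed.
Lemma ImD : {morph (im : C -> R) : x y / x + y}. Proof. by case=> ? ? []. Qed.

Lemma complexes_abs_complete : abs_complete C.
Proof.
move=> u [M HM].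
have part (p : C -> R) : {morph p : x y / x + y} -> p 0 = 0 ->
    (forall x : C, `|p x| <= re `|x|) -> cvgn (series (p \o u)).
  move=> pD p0 ple; apply: (@bounded_real_series _ (re M)) => n.
  have := HM n; rewrite lecE => /andP[_]; apply: le_trans.
  rewrite (morph_sum_ord (p := re) (fun i => `|u i|) n ReD)//; apply: ler_sum => i _; apply: ple.
have cRe : cvgn (series (re \o u)).
  apply: part => // [|x]; first exact: ReD.
  by have := normc_ge_Re x; rewrite lecE => /andP[_].
have cIm : cvgn (series (im \o u)).
  apply: part => // [|x]; first exact: ImD.
  rewrite normc_def /= -sqrtr_sqr; apply: ler_wsqrtr.
  by rewrite lerDr sqr_ge0.
pose l : C := Complex (limn (series (re \o u))) (limn (series (im \o u))).
exists l; apply/sumsP => e e0.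
have Ee : e = ((re e)%:C)%C.
  by case: e e0 => a b; rewrite ltcE /= => /andP[/eqP -> _].
have Re0 : 0 < re e by move: e0; rewrite ltcE => /andP[].
have e2 : 0 < re e / 2 by rewrite divr_gt0.
have [N1 _ H1] := (cvgrPdist_lt _ _).1 cRe _ e2.
have [N2 _ H2] := (cvgrPdist_lt _ _).1 cIm _ e2.
exists (maxn N1 N2) => n; rewrite geq_max => /andP[/H1 h1 /H2 h2].
apply: le_lt_trans (normc_le_ReIm _) _; rewrite Ee ltcE /= eqxx /=.
have SR : re (\sum_(i < n) u i) = series (re \o u) n.
  by rewrite (morph_sum_ord (p := re) u n ReD)// /series /= big_mkord.
have SI : im (\sum_(i < n) u i) = series (im \o u) n.
  by rewrite (morph_sum_ord (p := im) u n ImD)// /series /= big_mkord.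
have D1 (z : C) : re (l - z) = limn (series (re \o u)) - re z.
  by case: z.
have D2 (z : C) : im (l - z) = limn (series (im \o u)) - im z.
  by case: z.
rewrite D1 D2 SR SI [ltRHS](_ : _ = re e / 2 + re e / 2).
  exact: ltrD.
by rewrite -splitr.
Qed.

End Completeness.

(** * Rational functions near infinity and conclusion *)

Section Infinity.
Variable K : numFieldType.
Implicit Types (p q : {poly K}) (x : K).

Lemma horner_le_infty p : exists2 C : K, 0 < C &
  forall x, 1 <= `|x| -> `|p.[x]| <= C * `|x| ^+ (size p).-1.
Proof.
exists (1 + \sum_(i < size p) `|p`_i|) => [|x x1].
  by rewrite ltr_pwDl// sumr_ge0.
rewrite horner_coef; apply: le_trans (ler_norm_sum _ _ _) _.
rewrite mulrDl mul1r mulr_suml; apply: ler_wpDl; first exact: exprn_ge0.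
apply: ler_sum => i _; rewrite normrM normrX ler_wpM2l//.
by rewrite ler_weXn2l//; have := ltn_ord i; case: (size p) i => // n i; rewrite ltnS.
Qed.

(** For large x the leading term is at least twice the sum of the others. *)
Lemma horner_ge_infty p : p != 0 -> exists c r : K, [/\ 0 < c, 0 <= r &
  forall x, r < `|x| -> c * `|x| ^+ (size p).-1 <= `|p.[x]|].
Proof.
move=> p0; have [m Em] : exists m, size p = m.+1.
  by exists (size p).-1; rewrite prednK// size_poly_gt0.
pose S := \sum_(i < m) `|p`_i|; pose l := lead_coef p.
have S0 : 0 <= S by apply: sumr_ge0.
have l0 : 0 < `|l| by rewrite normr_gt0 lead_coef_eq0.
have r0 : 0 <= 2 * S / `|l| by rewrite divr_ge0// mulr_ge0.
exists (`|l| / 2), (1 + 2 * S / `|l|); split; [by rewrite divr_gt0|by rewrite addr_ge0|].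
move=> x rx; rewrite Em /=.
have x1 : 1 <= `|x| by apply/ltW/(le_lt_trans _ rx); rewrite lerDl.
have x0 : 0 < `|x| by apply: lt_le_trans ltr01 x1.
have Sx : S <= `|l| / 2 * `|x|.
  have : 2 * S / `|l| < `|x| by apply: le_lt_trans rx; rewrite lerDr.
  rewrite ltr_pdivrMr// => /ltW h; rewrite mulrAC ler_pdivlMr//.
  by rewrite mulrC [leRHS]mulrC.
rewrite -(ler_pM2l x0) horner_coef Em big_ord_recr /=.
have -> : p`_m = l by rewrite /l lead_coefE Em.
have low : `|x| * `|\sum_(i < m) p`_i * x ^+ i| <= S * `|x| ^+ m.
  apply: le_trans (ler_wpM2l (ltW x0) (ler_norm_sum _ _ _)) _.
  rewrite mulr_sumr mulr_suml; apply: ler_sum => i _.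
  rewrite normrM normrX mulrCA -exprS ler_wpM2l//.
  by rewrite ler_weXn2l// ltn_ord.
have tri : `|l * x ^+ m| - `|\sum_(i < m) p`_i * x ^+ i| <=
    `|\sum_(i < m) p`_i * x ^+ i + l * x ^+ m|.
  by rewrite [X in _ <= `|X|]addrC; apply: lerB_normD.
apply: le_trans (ler_wpM2l (ltW x0) tri).
rewrite mulrBr; apply: le_trans (lerB (lexx _) low).
rewrite lerBrDr normrM normrX.
apply: le_trans (lerD (lexx _) (ler_wpM2r _ Sx)) _; first exact: exprn_ge0.
by rewrite le_eqVlt; apply/orP; left; apply/eqP; field.
Qed.

Lemma decay_of_lim (f : K -> K) p q : q != 0 ->
  (forall x, q.[x] != 0 -> f x = p.[x] / q.[x]) ->
  f x @[x --> infty_nbhs K] --> (0 : K) -> (size p < size q)%N.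
Proof.
move=> q0 fE f0; rewrite ltnNge; apply/negP => le_qp.
have p0 : p != 0.
  by rewrite -size_poly_gt0 (leq_trans _ le_qp)// size_poly_gt0.
have [c [r [c0 r0 pge]]] := horner_ge_infty p0.
have [C C0 qle] := horner_le_infty q.
have [c' [r' [c'0 r'0 qge]]] := horner_ge_infty q0.
have /cvgrPdist_lt /(_ (c / C)) := f0; rewrite divr_gt0// => /(_ isT)[s [sr Hs]].
pose x : K := `|s| + r + r' + 1.
have s_ge : 0 <= `|s| by [].
have x_gt0 : 0 < x by rewrite /x ltr_wpDl// !addr_ge0.
have nx : `|x| = x by rewrite gtr0_norm.
have x1 : 1 <= `|x| by rewrite nx /x lerDr !addr_ge0.
have xr : r < `|x|.
  by rewrite nx /x -addrA -addrA addrCA ltrDl addrCA ltr_wpDl// ltr_wpDl.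
have xr' : r' < `|x|.
  by rewrite nx /x addrAC ltrDr ltr_wpDl// addr_ge0.
have xs : s < `|x|.
  apply: le_lt_trans (real_ler_norm sr) _.
  by rewrite nx /x -!addrA ltrDl !ltr_wpDl.
have qx : q.[x] != 0.
  rewrite -normr_gt0; apply: lt_le_trans (qge x xr').
  by rewrite mulr_gt0// exprn_gt0// nx.
have := Hs x xs; rewrite /= sub0r normrN fE// normf_div ltr_pdivrMr ?normr_gt0//.
move=> lt.
have : c * `|x| ^+ (size p).-1 < c * `|x| ^+ (size q).-1.
  apply: le_lt_trans (pge x xr) _; apply: lt_le_trans lt _.
  by rewrite mulrAC ler_pdivrMr// -mulrA ler_wpM2l ?(ltW c0)// mulrC qle.
rewrite ltr_pM2l// => /lt_le_trans => /(_ (`|x| ^+ (size p).-1)).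
rewrite ltxx ler_weXn2l//; first by move=> /(_ isT).
by rewrite -!subn1 leq_sub2r.
Qed.

Lemma bigO_of_degree (f : K -> K) p q i : q != 0 ->
  (forall x, q.[x] != 0 -> f x = p.[x] / q.[x]) ->
  (p != 0 -> (size p + i <= size q)%N) ->
  let oo := infty_nbhs K in f =O_oo (fun x : K => x ^- i).
Proof.
move=> q0 fE deg oo; apply/eqO_exP.
have [c [r [c0 r0 qge]]] := horner_ge_infty q0.
have [C C0 ple] := horner_le_infty p.
exists (C / c); first by rewrite divr_gt0.
exists (r + 1); split; first by rewrite realD ?ger0_real.
move=> x rx.
have xr : r < `|x| by apply: lt_trans rx; rewrite ltrDl.
have x1 : 1 <= `|x| by apply/ltW/(le_lt_trans _ rx); rewrite lerDr.
have x0 : 0 < `|x| by apply: lt_le_trans ltr01 x1.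
have qx : q.[x] != 0.
  by rewrite -normr_gt0; apply: lt_le_trans (qge x xr); rewrite mulr_gt0// exprn_gt0.
rewrite fE// normf_div normfV normrX ler_pdivrMr ?normr_gt0//.
have [->|p0] := eqVneq p 0.
  by rewrite horner0 normr0 !mulr_ge0// ?invr_ge0 ?exprn_ge0// ltW.
apply: le_trans (ple x x1) _.
apply: le_trans (_ : C / c / `|x| ^+ i * (c * `|x| ^+ (size q).-1) <= _); last first.
  by rewrite ler_wpM2l ?qge// !mulr_ge0// ?invr_ge0 ?exprn_ge0// ltW.
have Esz : (size q).-1 = ((size q).-1 - i + i)%N.
  have := deg p0; have : (0 < size p)%N by rewrite size_poly_gt0.
  by clear; lia.
rewrite Esz exprD.
have -> : C / c / `|x| ^+ i * (c * (`|x| ^+ ((size q).-1 - i) * `|x| ^+ i))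
   = C * `|x| ^+ ((size q).-1 - i).
  by field; rewrite expf_neq0 ?gt_eqF.
rewrite ler_wpM2l ?(ltW C0)// ler_weXn2l//.
by have := deg p0; clear; lia.
Qed.

End Infinity.

Section RationalFunctions.
Variable K : numFieldType.

Lemma rational_monic (f : K -> K) : rational_fun f ->
  exists pq : {poly K} * {poly K}, pq.2 \is monic /\
    forall x, pq.2.[x] != 0 -> f x = pq.1.[x] / pq.2.[x].
Proof.
move=> [p [q [q0 fE]]]; have l0 : lead_coef q != 0 by rewrite lead_coef_eq0.
exists ((lead_coef q)^-1 *: p, (lead_coef q)^-1 *: q); split=> /=.
  by rewrite monicE lead_coefZ mulVf.
move=> x; rewrite !hornerZ mulf_eq0 negb_or => /andP[_ qx].
by rewrite fE//; field; rewrite qx l0.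
Qed.

Lemma rational_taylor (f : K -> K) p q a u : q != 0 ->
  (forall x, q.[x] != 0 -> f x = p.[x] / q.[x]) -> asymptotic f a u ->
  taylor a q * u = taylor a p.
Proof.
move=> q0 fE fu.
have iq0 : taylor a q <> 0.
  by rewrite -(rmorph0 (taylor a)) => /taylor_inj /eqP; rewrite (negPf q0).
have [d d0 qd] := asymptotic_neq0 (asymptotic_horner q a) iq0.
apply: (asymptotic_unique (asymptotic_mul (asymptotic_horner q a) fu)
  (asymptotic_horner p a) d0) => x /qd qx.
by rewrite fE// mulrCA mulfV// mulr1.
Qed.

End RationalFunctions.

Theorem theorem0p3 (R : realType) (N : nat)
    (V : nat -> complexes R -> complexes R) :
  (0 < N)%N ->
  (forall k, (k <= N)%N -> rational_fun (V k)) ->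
  (forall x, V N x = 1) ->
  (forall x, V N.-1 x = 0) ->
  bispectral N V ->
  (forall j, (j < N)%N -> V j x @[x --> infty_nbhs (complexes R)] --> (0 : complexes R)) ->
  regular_singular_at_infty N V.
Proof.
case: N => // M _ Vrat VN _ bis Vlim i /andP[i_gt0 le_iN].
have /choice[PQ PQP] : forall k, exists pq : {poly complexes R} * {poly complexes R},
    (k <= M.+1)%N -> pq.2 \is monic /\
    forall x, pq.2.[x] != 0 -> V k x = pq.1.[x] / pq.2.[x].
  move=> k; have [le|_] := leqP k M.+1; last by exists (0, 0).
  by have [pq H] := rational_monic (Vrat k le); exists pq.
have [a [v [Psi [m [A [f [theta [vV LPsi APsi [Psi0 fn tn]]]]]]]]] :=
  bispectral_formal (@complexes_abs_complete R) bis.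
have vN : v M.+1 = 1.
  apply: (asymptotic_unique (vV M.+1 (leqnn _)) (asymptotic_cst 1 a) ltr01) => x _.
  exact: VN.
have v_rat k : (k < M.+1)%N -> [/\ (PQ k).2 \is monic,
    taylor a (PQ k).2 * v k = taylor a (PQ k).1 & (size (PQ k).1 < size (PQ k).2)%N].
  move=> lt_k; have [mon VE] := PQP k (ltnW lt_k); have q0 := monic_neq0 mon.
  split=> //; first exact: rational_taylor q0 VE (vV k (ltnW lt_k)).
  exact: decay_of_lim q0 VE (Vlim k lt_k).
have lt_k : (M.+1 - i < M.+1)%N by rewrite ltn_subrL i_gt0.
have [mon VE] := PQP _ (ltnW lt_k).
apply: (bigO_of_degree (monic_neq0 mon) VE) => p0.
have := @formal_regular_singular (complex R) a M v (fun k => (PQ k).1)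
  (fun k => (PQ k).2) vN v_rat Psi m A f theta LPsi APsi Psi0 fn tn _ lt_k p0.
by rewrite subKn.
Qed.
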